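(* Let $\mathcal{H}(T,A,\mu)$ be a Cauchy--de Branges space and $N\in\mathbb{N}$, $N\ge1$. The following are equivalent: (i) $\mathcal{H}(T,A,\mu)$ contains a nearly invariant subspace $\mathcal{H}_0$ of codimension $N$; (ii) the closure of $\mathcal{D}_{z^N}=\{F\in\mathcal{H}(T,A,\mu): z^NF\in\mathcal{H}(T,A,\mu)\}$ is a subspace of codimension $N$; (iii) $\sum_n|t_n|^{2N-2}\mu_n<\infty$. In this case the nearly invariant subspace of codimension $N$ is unique and equals $\overline{\mathcal{D}_{z^N}}=\{B_0,\dots,B_{N-1}\}^\perp$, where $$B_j(z)=A(z)\sum_n\frac{\overline{t_n}^{\,j}\mu_n}{z-t_n},\qquad j=0,\dots,N-1.$$
   Context: Let $T=\{t_n\}_{n\ge1}\subset\mathbb{C}$ be a set of distinct points with $|t_n|\to\infty$, and let $\mu_n>0$ satisfy $\sum_n\frac{\mu_n}{|t_n|^2+1}<\infty$. Let $A$ be an entire function with simple zeros exactly at the points of $T$ and no other zeros. The Cauchy--de Branges space is $\mathcal{H}(T,A,\mu)=\{F(z)=A(z)\sum_n\frac{c_n\mu_n^{1/2}}{z-t_n}:(c_n)\in\ell^2\}$ with norm $\|F\|=\|(c_n)\|_{\ell^2}$. A closed linear subspace $\mathcal{H}_0\subset\mathcal{H}(T,A,\mu)$ is nearly invariant if $f\in\mathcal{H}_0$, $f(w)=0$ imply $\frac{f(z)}{z-w}\in\mathcal{H}_0$. *)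

(* Defs.v *)
From Stdlib Require Import Reals.
From Coquelicot Require Import Coquelicot.
Open Scope R_scope.

Definition l2 (c : nat -> C) : Prop := ex_series (fun n => (Cmod (c n)) ^ 2).

Definition CdB_data (t : nat -> C) (mu : nat -> R) (A : C -> C) : Prop :=
  (forall m n, t m = t n -> m = n) /\
  is_lim_seq (fun n => Cmod (t n)) p_infty /\
  (forall n, 0 < mu n) /\
  ex_series (fun n => mu n / ((Cmod (t n)) ^ 2 + 1)) /\
  (forall z, ex_derive (K := C_AbsRing) (V := C_NormedModule) A z) /\
  (forall z, A z = 0 <-> exists n, z = t n) /\
  (forall n, ~ is_derive (K := C_AbsRing) (V := C_NormedModule) A (t n) (RtoC 0)).

(* F(z) = A(z) sum_n c_n mu_n^{1/2} / (z - t_n), understood as the entire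
   function: given by the series off T and extended continuously to T. *)
Definition rep (t : nat -> C) (mu : nat -> R) (A : C -> C)
    (c : nat -> C) (F : C -> C) : Prop :=
  (forall z, continuous F z) /\
  (forall z, (forall n, z <> t n) ->
     exists S : C, is_series (fun n => (c n * RtoC (sqrt (mu n)) / (z - t n))%C) S
               /\ F z = (A z * S)%C).

Definition InH t mu A (F : C -> C) : Prop :=
  exists c, l2 c /\ rep t mu A c F.

(* <F, G> = v, computed on the coefficient sequences (the norm is the l^2 norm) *)
Definition isInner t mu A (F G : C -> C) (v : C) : Prop :=
  exists c d, l2 c /\ rep t mu A c F /\ l2 d /\ rep t mu A d G /\
    is_series (fun n => (c n * Cconj (d n))%C) v.

Definition subspaceH t mu A (S : (C -> C) -> Prop) : Prop :=
  (forall F, S F -> InH t mu A F) /\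
  S (fun _ => 0%C) /\
  (forall F G, S F -> S G -> S (fun z => F z + G z)%C) /\
  (forall (a : C) F, S F -> S (fun z => a * F z)%C).

Definition convH t mu A (Fk : nat -> C -> C) (F : C -> C) : Prop :=
  exists (ck : nat -> nat -> C) (c : nat -> C),
    (forall k, l2 (ck k) /\ rep t mu A (ck k) (Fk k)) /\
    l2 c /\ rep t mu A c F /\
    is_lim_seq (fun k => Series (fun n => (Cmod (ck k n - c n)) ^ 2)) 0.

Definition closedH t mu A (S : (C -> C) -> Prop) : Prop :=
  forall Fk F, (forall k, S (Fk k)) -> convH t mu A Fk F -> S F.

Definition closed_subspaceH t mu A S : Prop :=
  subspaceH t mu A S /\ closedH t mu A S.

Definition closureH t mu A (S : (C -> C) -> Prop) (F : C -> C) : Prop :=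
  InH t mu A F /\ exists Fk, (forall k, S (Fk k)) /\ convH t mu A Fk F.

Definition codimH t mu A (S : (C -> C) -> Prop) (N : nat) : Prop :=
  subspaceH t mu A S /\
  exists G : nat -> C -> C,
    (forall i, (i < N)%nat -> InH t mu A (G i)) /\
    (forall F, InH t mu A F -> exists (a : nat -> C) (h : C -> C),
        S h /\ forall z, F z = (h z + sum_n (fun i => a i * G i z) (N - 1))%C) /\
    (forall a : nat -> C,
        S (fun z => sum_n (fun i => a i * G i z) (N - 1))%C ->
        forall i, (i < N)%nat -> a i = 0%C).

Definition nearly_invariant (S : (C -> C) -> Prop) : Prop :=
  forall f w, S f -> f w = 0%C ->
    exists g, S g /\ forall z, f z = ((z - w) * g z)%C.

Definition DzN t mu A (N : nat) (F : C -> C) : Prop :=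
  InH t mu A F /\ InH t mu A (fun z => pow_n z N * F z)%C.

(* coefficients of B_j:  c_n mu_n^{1/2} = conj(t_n)^j mu_n *)
Definition Bcoef (t : nat -> C) (mu : nat -> R) (j : nat) (n : nat) : C :=
  (pow_n (Cconj (t n)) j * RtoC (sqrt (mu n)))%C.

Definition perpB t mu A (N : nat) (F : C -> C) : Prop :=
  InH t mu A F /\
  forall j, (j < N)%nat ->
    exists Bj, rep t mu A (Bcoef t mu j) Bj /\ isInner t mu A F Bj 0%C.

(* Main.v *)
(** Under [F |-> c], [F] is in [D_(z^N)] iff [c] and [t^N c] are square summable and the
    moments [sum t_n^j c_n mu_n^(1/2)], [j < N], vanish.  If [H0] is nearly invariant of
    codimension [N] and [F] is in [D_(z^N)], then [F, zF, ..., z^N F] are linearly dependent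
    modulo [H0], so [p F] lies in [H0] for a nonzero polynomial [p]; dividing by the linear
    factors of [p] puts [F], hence the closure of [D_(z^N)], in [H0].  This closure is the
    annihilator of those moments of order [j < N] that are continuous, i.e. for which
    [conj(t_n)^j mu_n^(1/2)] is square summable: a discontinuous moment can be corrected by
    finitely supported vectors of arbitrarily small norm on which the lower moments vanish.
    So it has codimension at most [N - 1] unless [sum |t_n|^(2N-2) mu_n] converges, and is
    exactly [{B_0, ..., B_(N-1)}^perp], of codimension [N], otherwise. *)

Require Import Defs.
From Stdlib Require Import Reals Lra Lia List Classical ClassicalEpsilon.
From Stdlib Require Import FunctionalExtensionality PropExtensionality.
From Coquelicot Require Import Coquelicot.
From mathcomp Require all_boot all_algebra complex Rstruct.
Open Scope R_scope.

(** * Linear systems and factorisation of polynomials over C *)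

(** Near invariance speaks of point values, the estimates speak of coefficients, and at a node the
    series for F is meaningless. The link is the value forced by continuity, F(t_m) = A'(t_m) c_m
    mu_m^(1/2). It makes F determine c, and it turns f = (z - w) g into c_n = (t_n - w) d_n together
    with the vanishing of the moment of order 0 of d. Iterating this one equivalence describes
    D_(z^N) and shows that vanishing moments define a nearly invariant subspace. Moments are
    annihilated in increasing order, so a correction at one order must not spoil the lower ones;
    divided differences over the nodes are finitely supported vectors with this property. Finite
    support matters because t^k c is then square summable for every k, and membership in D_(z^N)
    reduces to moments. Uniqueness is a dimension count: H0 contains the closure, modulo which N
    functions already span. Every dimension count rests on one fact: a square matrix with a zero
    column has a nonzero left kernel. *)

Module ComplexAlgebra.
Import all_boot all_algebra complex Rstruct.
Import GRing.Theory.

Local Definition toRi (z : C) : complex R := Complex (fst z) (snd z).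
Local Definition ofRi (z : complex R) : C := (Re z, Im z).

Local Lemma ofRiK z : toRi (ofRi z) = z.
Proof. by case: z. Qed.

Local Lemma toRiK z : ofRi (toRi z) = z.
Proof. by case: z. Qed.

Local Lemma toRi_inj x y : toRi x = toRi y -> x = y.
Proof. by move=> e; rewrite -(toRiK x) e toRiK. Qed.

Local Lemma toRiD x y : toRi (Cplus x y) = (toRi x + toRi y)%R.
Proof. by case: x y => a b [c d]. Qed.

Local Lemma toRiM x y : toRi (Cmult x y) = (toRi x * toRi y)%R.
Proof. by case: x y => a b [c d]. Qed.

Local Lemma toRiN x : toRi (Copp x) = (- toRi x)%R.
Proof. by case: x. Qed.

Local Lemma toRi0 : toRi (RtoC 0) = 0%R.
Proof. by []. Qed.

Local Lemma toRi_sum (u : nat -> C) n :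
  toRi (sum_n u n) = (\sum_(i < n.+1) toRi (u i))%R.
Proof.
elim: n => [|n IH]; first by rewrite sum_O big_ord_recl big_ord0 addr0.
by rewrite sum_Sn big_ord_recr /= -IH -toRiD.
Qed.

Local Lemma toRi_pow z n : toRi (pow_n z n) = (toRi z ^+ n)%R.
Proof. by elim: n => [|n IH] //=; rewrite exprS -IH -toRiM. Qed.

(** The transfer to [complex R] gives access to algebraic closedness. Roots are listed with
    multiplicity because near invariance removes one linear factor at a time. *)
Lemma poly_factor (n : nat) (b : nat -> C) :
  (exists i, Peano.le i n /\ b i <> RtoC 0) ->
  exists (k : C) (rs : list C), k <> RtoC 0 /\ forall z,
    sum_n (fun i => Cmult (b i) (pow_n z i)) n
    = Cmult k (fold_right (fun r y => Cmult (Cminus z r) y) (RtoC 1) rs).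
Proof.
move=> [i0 [/leP i0n bi0]].
pose p : {poly complex R} := (\poly_(i < n.+1) toRi (b i))%R.
have [rs ep] := closed_field_poly_normal p.
exists (ofRi (lead_coef p)), (map ofRi rs); split=> [l0|z].
  have : lead_coef p = 0%R by rewrite -(ofRiK (lead_coef p)) l0.
  move=> /eqP; rewrite lead_coef_eq0 => /eqP p0; apply: bi0; apply: toRi_inj.
  by rewrite toRi0 -(coef0 _ i0) -p0 coef_poly ltnS i0n.
apply: toRi_inj; rewrite toRi_sum toRiM ofRiK.
transitivity (p.[toRi z])%R.
  by rewrite horner_poly; apply: eq_bigr => i _; rewrite toRiM toRi_pow.
rewrite {1}ep hornerZ; congr (_ * _)%R; elim: (rs) => [|r s IH].
  by rewrite big_nil hornerC.
by rewrite big_cons hornerM IH /= toRiM /Cminus toRiD toRiN ofRiK !hornerE.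
Qed.

(** A square matrix that kills a basis vector cannot be row-free, since a right inverse would also
    be a left inverse. The zero column encodes that the [n] rows live in dimension [n - 1]. *)
Lemma singular_kernel (n p : nat) (M : nat -> nat -> C) :
  Peano.lt p n -> (forall i, Peano.lt i n -> M i p = RtoC 0) ->
  exists b : nat -> C, (exists i, Peano.lt i n /\ b i <> RtoC 0) /\
    forall l, Peano.lt l n ->
      sum_n (fun i => Cmult (b i) (M i l)) (Nat.sub n 1) = RtoC 0.
Proof.
case: n => [|n] /ltP pn Mp; first by [].
pose A : 'M[complex R]_n.+1 := (\matrix_(i, j) toRi (M i j))%R.
have Asing : ~~ row_free A.
  apply/negP => /row_freeP [B AB].
  have A0 : (A *m (delta_mx (Ordinal pn) ord0 : 'cV_n.+1) = 0)%R.
    rewrite -colE; apply/matrixP => i j; rewrite !mxE Mp ?toRi0 //.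
    exact/ltP.
  have /mulmx1C BA := AB.
  have : (B *m (A *m (delta_mx (Ordinal pn) ord0 : 'cV_n.+1)) = 0)%R.
    by rewrite A0 mulmx0.
  rewrite mulmxA BA mul1mx => /matrixP /(_ (Ordinal pn) ord0).
  by rewrite !mxE !eqxx => /eqP; rewrite oner_eq0.
have /rowV0Pn [v vk v0] : (kermx A != 0)%R by rewrite kermx_eq0.
have vA : (v *m A = 0)%R by apply/sub_kermxP.
exists (fun i => ofRi (v ord0 (inord i))); split.
  have /rV0Pn [i vi] := v0.
  exists i; split; first exact/ltP.
  rewrite inord_val => e; move: vi => /eqP; apply.
  by rewrite -(ofRiK (v ord0 i)) e.
move=> l /ltP ln; apply: toRi_inj; have -> : Nat.sub n.+1 1 = n by case: (n).
  rewrite toRi_sum toRi0.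
have vAl : (v *m A)%R ord0 (Ordinal ln) = 0%R by rewrite vA mxE.
rewrite -[RHS]vAl mxE; apply: eq_bigr => i _.
by rewrite toRiM ofRiK inord_val mxE.
Qed.

End ComplexAlgebra.

(** * Complex series and square summable sequences *)

Lemma Cmod_pow_n (z : C) (n : nat) : Cmod (pow_n z n) = Cmod z ^ n.
Proof.
  induction n as [|n IH]; simpl; [exact Cmod_1|].
  change (Cmod (z * pow_n z n)%C = Cmod z * Cmod z ^ n).
  now rewrite Cmod_mult, IH.
Qed.

Lemma Cpow_nS (z : C) (n : nat) : pow_n z (S n) = (z * pow_n z n)%C.
Proof. reflexivity. Qed.

Lemma Cmod_minus_sym (x y : C) : Cmod (x - y)%C = Cmod (y - x)%C.
Proof. rewrite <- Cmod_opp. f_equal. ring. Qed.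

Lemma Cminus_eq0 (x y : C) : (x - y)%C = 0%C -> x = y.
Proof. intros H. replace x with (x - y + y)%C by ring. rewrite H. ring. Qed.

Lemma Cmod_triangle_minus (x y : C) : Cmod (x - y)%C <= Cmod x + Cmod y.
Proof.
  rewrite <- (Cmod_opp y). apply Cmod_triangle.
Qed.

Lemma Cmod_sub_ge (x y : C) : Cmod x - Cmod y <= Cmod (x - y)%C.
Proof.
  assert (H := Cmod_triangle (x - y)%C y).
  replace (x - y + y)%C with x in H by ring. lra.
Qed.

(** The uniform structure of [C] is the product one; its neighbourhoods agree with those of [Cmod],
    in which all later estimates are made. *)
Lemma continuous_C_eps (F : C -> C) (z : C) :
  continuous F z <->
  forall eps, 0 < eps -> exists delta, 0 < delta /\
    forall y, Cmod (y - z)%C < delta -> Cmod (F y - F z)%C < eps.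
Proof.
  split.
  - intros HF eps Heps.
    assert (H := proj1 (filterlim_locally_ball_norm (K := C_AbsRing)
                 (U := C_NormedModule) F (F z)) HF (mkposreal _ Heps)).
    destruct (locally_norm_le_locally (K := C_AbsRing) (V := C_NormedModule) z _ H)
      as [d Hd].
    exists d; split; [apply cond_pos|]. intros y Hy. exact (Hd y Hy).
  - intros H.
    apply (proj2 (filterlim_locally_ball_norm (K := C_AbsRing)
                 (U := C_NormedModule) F (F z))).
    intros eps. destruct (H eps (cond_pos eps)) as (d & Hd & Hy).
    apply (locally_le_locally_norm (K := C_AbsRing) (V := C_NormedModule) z).
    exists (mkposreal _ Hd). intros y Hyd. exact (Hy y Hyd).
Qed.

Lemma is_derive_C_eps (A : C -> C) (z l : C) :
  is_derive (K := C_AbsRing) (V := C_NormedModule) A z l ->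
  forall eps, 0 < eps -> exists delta, 0 < delta /\
    forall y, Cmod (y - z)%C < delta ->
      Cmod (A y - A z - (y - z) * l)%C <= eps * Cmod (y - z)%C.
Proof.
  intros [_ H] eps Heps.
  destruct (locally_norm_le_locally (K := C_AbsRing) _ _
    (H z (fun P HP => HP) (mkposreal _ Heps))) as [d Hd].
  exists d; split; [apply cond_pos|]. intros y Hy. exact (Hd y Hy).
Qed.

Lemma is_derive_C_continuous_eps (A : C -> C) (z l : C) :
  is_derive (K := C_AbsRing) (V := C_NormedModule) A z l ->
  forall eps, 0 < eps -> exists delta, 0 < delta /\
    forall y, Cmod (y - z)%C < delta -> Cmod (A y - A z)%C < eps.
Proof.
  intros H eps Heps.
  destruct (is_derive_C_eps A z l H 1 Rlt_0_1) as (d & Hd & Hy).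
  assert (Hl := Cmod_ge_0 l).
  exists (Rmin d (eps / (Cmod l + 2))). split.
  - apply Rmin_glb_lt; [assumption|]. apply Rdiv_lt_0_compat; lra.
  - intros y Hyd.
    specialize (Hy y (Rlt_le_trans _ _ _ Hyd (Rmin_l _ _))).
    assert (Hy2 := Rlt_le_trans _ _ _ Hyd (Rmin_r _ _)).
    replace (A y - A z)%C with ((A y - A z - (y - z) * l) + (y - z) * l)%C by ring.
    eapply Rle_lt_trans; [apply Cmod_triangle|].
    rewrite Cmod_mult. set (r := Cmod (y - z)%C) in *.
    assert (0 <= r) by apply Cmod_ge_0.
    apply Rle_lt_trans with (r * (Cmod l + 1)); [nra|].
    apply Rle_lt_trans with (eps / (Cmod l + 2) * (Cmod l + 1)); [nra|].
    apply Rlt_le_trans with (eps / (Cmod l + 2) * (Cmod l + 2)); [|right; field; lra].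
    apply Rmult_lt_compat_l; [|lra]. apply Rdiv_lt_0_compat; lra.
Qed.

Notation Cis_series := (is_series (K := C_AbsRing) (V := C_NormedModule)).
Notation Csum_n := (@sum_n C_AbelianMonoid).

Lemma Cis_series_ext (a b : nat -> C) (l : C) :
  (forall n, a n = b n) -> Cis_series a l -> Cis_series b l.
Proof. apply is_series_ext. Qed.

Lemma Cis_series_plus (a b : nat -> C) (la lb : C) :
  Cis_series a la -> Cis_series b lb ->
  Cis_series (fun n => a n + b n)%C (la + lb)%C.
Proof. apply (is_series_plus (K := C_AbsRing) (V := C_NormedModule)). Qed.

Lemma Cis_series_scal (k : C) (a : nat -> C) (l : C) :
  Cis_series a l -> Cis_series (fun n => k * a n)%C (k * l)%C.
Proof. apply (is_series_scal (K := C_AbsRing) (V := C_NormedModule)). Qed.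

Lemma Cis_series_minus (a b : nat -> C) (la lb : C) :
  Cis_series a la -> Cis_series b lb ->
  Cis_series (fun n => a n - b n)%C (la - lb)%C.
Proof. apply (is_series_minus (K := C_AbsRing) (V := C_NormedModule)). Qed.

Lemma Cis_series_unique (a : nat -> C) (l l' : C) :
  Cis_series a l -> Cis_series a l' -> l = l'.
Proof.
  intros H H'.
  exact (filterlim_locally_unique (V := C_NormedModule) _ _ _ H H').
Qed.

Lemma Cex_series_abs (a : nat -> C) :
  ex_series (fun n => Cmod (a n)) -> exists l, Cis_series a l.
Proof.
  intros H.
  exact (ex_series_le (K := C_AbsRing) (V := C_CompleteNormedModule) a _
           (fun n => Rle_refl _) H).
Qed.

Lemma is_lim_seq_le_const (u : nat -> R) (l M : R) :
  is_lim_seq u l -> (forall n, u n <= M) -> l <= M.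
Proof.
  intros H Hu.
  exact (is_lim_seq_le u (fun _ => M) l M Hu H (is_lim_seq_const M)).
Qed.

Lemma sum_n_le_Series (a : nat -> R) (n : nat) :
  (forall n, 0 <= a n) -> ex_series a -> sum_n a n <= Series a.
Proof.
  intros Ha [l Hl]. rewrite (is_series_unique _ _ Hl).
  refine (is_lim_seq_incr_compare (sum_n a) l Hl _ n).
  intros k. rewrite sum_Sn. unfold plus; simpl. specialize (Ha (S k)). lra.
Qed.

Lemma term_le_Series (a : nat -> R) (n : nat) :
  (forall n, 0 <= a n) -> ex_series a -> a n <= Series a.
Proof.
  intros Ha Hex. eapply Rle_trans; [|apply (sum_n_le_Series a n Ha Hex)].
  destruct n as [|n]; [rewrite sum_O; lra|].
  rewrite sum_Sn. unfold plus; simpl.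
  enough (0 <= sum_n a n) by lra.
  induction n as [|n IH]; [rewrite sum_O; apply Ha|].
  rewrite sum_Sn. unfold plus; simpl. specialize (Ha (S n)). lra.
Qed.

Lemma Series_nonneg (a : nat -> R) :
  (forall n, 0 <= a n) -> ex_series a -> 0 <= Series a.
Proof.
  intros Ha Hex. eapply Rle_trans; [apply (Ha 0%nat)|apply term_le_Series; assumption].
Qed.

Lemma Cmod_series_le (a : nat -> C) (l : C) :
  Cis_series a l -> ex_series (fun n => Cmod (a n)) ->
  Cmod l <= Series (fun n => Cmod (a n)).
Proof.
  intros Hl Hex.
  assert (H : is_lim_seq (fun n => Cmod (Csum_n a n)) (Cmod l)).
  { exact (filterlim_comp _ _ _ _ _ _ _ _ Hl
             (filterlim_norm (K := C_AbsRing) (V := C_NormedModule) l)). }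
  apply (is_lim_seq_le_const _ _ _ H). intros n.
  eapply Rle_trans;
    [apply (norm_sum_n_m (K := C_AbsRing) (V := C_NormedModule) a 0 n)|].
  apply sum_n_le_Series; [intros; apply Cmod_ge_0|assumption].
Qed.

Lemma is_series_eventually0 {K : AbsRing} {V : NormedModule K} (u : nat -> V) (k : nat) :
  (forall n, (k <= n)%nat -> u n = zero) -> is_series u (sum_n u k).
Proof.
  intros H. apply (filterlim_ext_loc (fun _ => sum_n u k)); [|apply filterlim_const].
  exists k. intros n Hn. induction Hn as [|n Hn IH]; [reflexivity|].
  rewrite sum_Sn, <- IH, (H (S n)) by lia. now rewrite plus_zero_r.
Qed.

Definition fin_supp (c : nat -> C) : Prop :=
  exists k, forall n, (k <= n)%nat -> c n = 0%C.

Lemma Cis_series_fin (u : nat -> C) :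
  fin_supp u -> exists l, Cis_series u l.
Proof.
  intros [k Hk]. exists (Csum_n u k).
  exact (is_series_eventually0 (K := C_AbsRing) (V := C_NormedModule) u k Hk).
Qed.

Lemma fin_supp_plus (c d : nat -> C) :
  fin_supp c -> fin_supp d -> fin_supp (fun n => c n + d n)%C.
Proof.
  intros [k Hk] [l Hl]. exists (Nat.max k l). intros n Hn.
  rewrite Hk, Hl by lia. ring.
Qed.

Lemma fin_supp_scal (a : C) (c : nat -> C) :
  fin_supp c -> fin_supp (fun n => a * c n)%C.
Proof. intros [k Hk]. exists k. intros n Hn. rewrite Hk by lia. ring. Qed.

(** * Squared norms and pairings of square summable sequences *)

Definition nrm2 (c : nat -> C) : R := Series (fun n => Cmod (c n) ^ 2).

Lemma sq_Cmod_nonneg (c : nat -> C) (n : nat) : 0 <= Cmod (c n) ^ 2.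
Proof. apply pow2_ge_0. Qed.

Lemma fin_supp_l2 (c : nat -> C) : fin_supp c -> l2 c.
Proof.
  intros [k Hk]. eexists.
  apply (is_series_eventually0 (K := R_AbsRing) (V := R_NormedModule) _ k).
  intros n Hn. rewrite (Hk n Hn), Cmod_0. change (0 ^ 2 = 0). ring.
Qed.

Lemma ex_series_Rle (a b : nat -> R) :
  (forall n, 0 <= a n <= b n) -> ex_series b -> ex_series a.
Proof.
  intros H. apply (ex_series_le (K := R_AbsRing) (V := R_CompleteNormedModule)).
  intros n. unfold norm; simpl. unfold abs; simpl.
  rewrite Rabs_pos_eq; apply H.
Qed.

Lemma l2_le (c d : nat -> C) :
  (forall n, Cmod (c n) <= Cmod (d n)) -> l2 d -> l2 c.
Proof.
  intros H. apply ex_series_Rle. intros n. split; [apply sq_Cmod_nonneg|].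
  apply pow_incr. split; [apply Cmod_ge_0|apply H].
Qed.

Lemma l2_scal (k : C) (c : nat -> C) : l2 c -> l2 (fun n => k * c n)%C.
Proof.
  intros H. apply (ex_series_ext (fun n => Cmod k ^ 2 * Cmod (c n) ^ 2)).
  - intros n. rewrite Cmod_mult. symmetry. apply Rpow_mult_distr.
  - apply (ex_series_scal (K := R_AbsRing) (V := R_NormedModule) (Cmod k ^ 2)); exact H.
Qed.

Lemma nrm2_scal (k : C) (c : nat -> C) :
  nrm2 (fun n => k * c n)%C = Cmod k ^ 2 * nrm2 c.
Proof.
  unfold nrm2. rewrite <- Series_scal_l. apply Series_ext.
  intros n. rewrite Cmod_mult. ring.
Qed.

Lemma sq_Cmod_plus_le (x y : C) :
  Cmod (x + y)%C ^ 2 <= 2 * Cmod x ^ 2 + 2 * Cmod y ^ 2.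
Proof.
  assert (H := Cmod_triangle x y). assert (H0 := Cmod_ge_0 (x + y)%C).
  assert (Hs := pow2_ge_0 (Cmod x - Cmod y)). nra.
Qed.

Lemma ex_series_sq_plus (c d : nat -> C) : l2 c -> l2 d ->
  ex_series (fun n => 2 * Cmod (c n) ^ 2 + 2 * Cmod (d n) ^ 2).
Proof.
  intros Hc Hd.
  apply (ex_series_plus (K := R_AbsRing) (V := R_NormedModule));
  apply (ex_series_scal (K := R_AbsRing) (V := R_NormedModule) 2); assumption.
Qed.

Lemma l2_plus (c d : nat -> C) : l2 c -> l2 d -> l2 (fun n => c n + d n)%C.
Proof.
  intros Hc Hd. refine (ex_series_Rle _ _ _ (ex_series_sq_plus c d Hc Hd)).
  intros n. split; [apply pow2_ge_0|apply sq_Cmod_plus_le].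
Qed.

(** The factor 2 replaces the triangle inequality for the norm and avoids square roots; only
    smallness matters later. *)
Lemma nrm2_plus (c d : nat -> C) : l2 c -> l2 d ->
  nrm2 (fun n => c n + d n)%C <= 2 * nrm2 c + 2 * nrm2 d.
Proof.
  intros Hc Hd. unfold nrm2.
  rewrite <- (Series_scal_l 2), <- (Series_scal_l 2 (fun n => Cmod (d n) ^ 2)), <- Series_plus.
  - apply Series_le; [|apply ex_series_sq_plus; assumption].
    intros n. split; [apply pow2_ge_0|apply sq_Cmod_plus_le].
  - apply (ex_series_scal (K := R_AbsRing) (V := R_NormedModule) 2); assumption.
  - apply (ex_series_scal (K := R_AbsRing) (V := R_NormedModule) 2); assumption.
Qed.

Lemma nrm2_nonneg (c : nat -> C) : l2 c -> 0 <= nrm2 c.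
Proof. apply Series_nonneg. apply sq_Cmod_nonneg. Qed.

Lemma l2_minus (c d : nat -> C) : l2 c -> l2 d -> l2 (fun n => c n - d n)%C.
Proof.
  intros Hc Hd. apply l2_plus; [assumption|].
  apply (l2_le _ d); [|assumption]. intros n. rewrite Cmod_opp. apply Rle_refl.
Qed.

Lemma AMGM (lam x y : R) : 0 < lam -> x * y <= lam / 2 * x ^ 2 + y ^ 2 / (2 * lam).
Proof.
  intros H.
  enough (0 <= lam / 2 * x ^ 2 + y ^ 2 / (2 * lam) - x * y) by lra.
  replace (lam / 2 * x ^ 2 + y ^ 2 / (2 * lam) - x * y)
    with ((lam * x - y) ^ 2 * / (2 * lam)) by (field; lra).
  apply Rmult_le_pos; [apply pow2_ge_0|]. left. apply Rinv_0_lt_compat. lra.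
Qed.

(** A weighted substitute for the Cauchy-Schwarz inequality: the free [lam] balances a factor of
    small norm against one of fixed norm. *)
Lemma l2_prod_bound (lam : R) (c d : nat -> C) : 0 < lam -> l2 c -> l2 d ->
  ex_series (fun n => Cmod (c n * d n)%C) /\
  Series (fun n => Cmod (c n * d n)%C) <= lam / 2 * nrm2 c + nrm2 d / (2 * lam).
Proof.
  intros Hlam Hc Hd.
  assert (H : forall n, 0 <= Cmod (c n * d n)%C
            <= lam / 2 * Cmod (c n) ^ 2 + / (2 * lam) * Cmod (d n) ^ 2).
  { intros n. split; [apply Cmod_ge_0|]. rewrite Cmod_mult.
    assert (H := AMGM lam (Cmod (c n)) (Cmod (d n)) Hlam).
    unfold Rdiv in *. lra. }
  assert (E1 : ex_series (fun n => lam / 2 * Cmod (c n) ^ 2))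
    by (apply (ex_series_scal (K := R_AbsRing) (V := R_NormedModule) (lam / 2)); assumption).
  assert (E2 : ex_series (fun n => / (2 * lam) * Cmod (d n) ^ 2))
    by (apply (ex_series_scal (K := R_AbsRing) (V := R_NormedModule) (/ (2 * lam))); assumption).
  assert (E := ex_series_plus (K := R_AbsRing) (V := R_NormedModule) _ _ E1 E2).
  split; [exact (ex_series_Rle _ _ H E)|].
  eapply Rle_trans; [apply (Series_le _ _ H E)|].
  rewrite Series_plus, !Series_scal_l by assumption.
  unfold nrm2, Rdiv. lra.
Qed.

Lemma l2_prod_ex (c d : nat -> C) : l2 c -> l2 d ->
  ex_series (fun n => Cmod (c n * d n)%C).
Proof. intros Hc Hd. exact (proj1 (l2_prod_bound 1 c d Rlt_0_1 Hc Hd)). Qed.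

Lemma l2_pairing_small (d : nat -> C) (eps : R) : l2 d -> 0 < eps ->
  exists delta, 0 < delta /\ forall c v, l2 c -> nrm2 c < delta ->
    Cis_series (fun n => c n * d n)%C v -> Cmod v < eps.
Proof.
  intros Hd Heps. assert (Hn := nrm2_nonneg d Hd).
  (* This [lam] brings the term with [nrm2 d] below [eps / 2], and [delta = eps / lam] does the same
     for the term with [nrm2 c]. The [+ 1] keeps [lam] positive when [d] is zero. *)
  set (lam := (nrm2 d + 1) / eps).
  assert (Hlam : 0 < lam) by (apply Rdiv_lt_0_compat; lra).
  exists (eps / lam). split; [apply Rdiv_lt_0_compat; lra|].
  intros c v Hc Hsm Hv.
  destruct (l2_prod_bound lam c d Hlam Hc Hd) as [E B].
  eapply Rle_lt_trans; [apply (Cmod_series_le _ _ Hv E)|].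
  eapply Rle_lt_trans; [exact B|].
  assert (lam / 2 * nrm2 c < lam / 2 * (eps / lam)) by (apply Rmult_lt_compat_l; lra).
  replace (lam / 2 * (eps / lam)) with (eps / 2) in * by (field; lra).
  enough (nrm2 d / (2 * lam) < eps / 2) by lra.
  unfold lam.
  replace (nrm2 d / (2 * ((nrm2 d + 1) / eps))) with (eps / 2 * (nrm2 d / (nrm2 d + 1)))
    by (field; lra).
  rewrite <- (Rmult_1_r (eps / 2)) at 2. apply Rmult_lt_compat_l; [lra|].
  apply Rmult_lt_reg_r with (nrm2 d + 1); [lra|].
  unfold Rdiv. rewrite Rmult_assoc, Rinv_l by lra. lra.
Qed.

(** * Functions and their coefficient sequences *)

Lemma Csub_neq0 (x y : C) : x <> y -> (x - y)%C <> (RtoC 0).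
Proof. intros H E. apply H, Cminus_eq0, E. Qed.

Lemma Cmod_lt_eps_eq (x y : C) :
  (forall eps, 0 < eps -> Cmod (x - y)%C < eps) -> x = y.
Proof.
  intros H. apply NNPP. intros Hn.
  assert (H0 := proj1 (Cmod_gt_0 _) (Csub_neq0 _ _ Hn)).
  specialize (H _ H0). lra.
Qed.

Lemma Cis_series_single (m : nat) (x : C) :
  Cis_series (fun n => if Nat.eqb n m then x else (RtoC 0)) x.
Proof.
  set (u := fun n => if Nat.eqb n m then x else (RtoC 0)).
  assert (H : Csum_n u m = x).
  { destruct m as [|m].
    - rewrite sum_O. reflexivity.
    - rewrite sum_Sn.
      replace (Csum_n u m) with (RtoC 0).
      + unfold u at 1. rewrite Nat.eqb_refl. apply Cplus_0_l.
      + symmetry. unfold u. change (RtoC 0) with (@zero C_AbelianMonoid).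
        rewrite (sum_n_ext_loc _ (fun _ => zero)).
        * unfold sum_n. apply sum_n_m_const_zero.
        * intros n Hn. destruct (Nat.eqb_spec n (S m)); [lia|reflexivity]. }
  assert (Hz : forall n, (S m <= n)%nat -> u n = zero).
  { intros n Hn. unfold u. destruct (Nat.eqb_spec n m); [lia|reflexivity]. }
  assert (HS := is_series_eventually0 (K := C_AbsRing) (V := C_NormedModule) u (S m) Hz).
  rewrite sum_Sn, (Hz (S m) (le_n _)), plus_zero_r in HS.
  change (Cis_series u (Csum_n u m)) in HS. rewrite H in HS. exact HS.
Qed.

Definition drop_index (m : nat) (u : nat -> C) (n : nat) : C :=
  if Nat.eqb n m then (RtoC 0) else u n.

(** Splits off one singular or freely chosen term: the rest is summed first, then the term is added
    back. *)
Lemma Cis_series_drop (m : nat) (u : nat -> C) (l : C) :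
  Cis_series (drop_index m u) l -> Cis_series u (l + u m)%C.
Proof.
  intros H.
  refine (Cis_series_ext _ _ _ _ (Cis_series_plus _ _ _ _ H (Cis_series_single m (u m)))).
  intros n. unfold drop_index. simpl. destruct (Nat.eqb_spec n m) as [->|]; ring.
Qed.

Section CauchyDeBranges.

Context (t : nat -> C) (mu : nat -> R) (A : C -> C) (Hdata : CdB_data t mu A).

Local Notation s n := (RtoC (sqrt (mu n))).
Local Notation offT z := (forall n, z <> t n).

Lemma sqrt_mu_neq0 (n : nat) : s n <> (RtoC 0).
Proof.
  destruct Hdata as (_ & _ & Hmu & _). intros E. apply RtoC_inj in E.
  specialize (sqrt_lt_R0 _ (Hmu n)). lra.
Qed.

Lemma node_inj (m n : nat) : t m = t n -> m = n.
Proof. apply Hdata. Qed.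

Lemma node_large (M : R) : exists n0, forall n, (n0 <= n)%nat -> M < Cmod (t n).
Proof.
  destruct Hdata as (_ & Hlim & _). exact (proj2 (is_lim_seq_spec _ _) Hlim M).
Qed.

Definition dA (m : nat) : C := C_derive A (t m).

Lemma is_derive_dA (m : nat) :
  is_derive (K := C_AbsRing) (V := C_NormedModule) A (t m) (dA m).
Proof.
  destruct Hdata as (_ & _ & _ & _ & HA & _).
  apply C_derive_correct; [exact (RtoC 0)|apply HA].
Qed.

Lemma dA_neq0 (m : nat) : dA m <> (RtoC 0).
Proof.
  intros E. assert (H := is_derive_dA m). rewrite E in H.
  destruct Hdata as (_ & _ & _ & _ & _ & _ & Hs). exact (Hs m H).
Qed.

Lemma A_node (m : nat) : A (t m) = (RtoC 0).
Proof.
  destruct Hdata as (_ & _ & _ & _ & _ & Hz & _). apply Hz. now exists m.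
Qed.

Lemma A_offT (z : C) : offT z -> A z <> (RtoC 0).
Proof.
  destruct Hdata as (_ & _ & _ & _ & _ & Hz & _). intros H E.
  destruct (proj1 (Hz z) E) as [n Hn]. exact (H n Hn).
Qed.

Lemma A_continuous_eps (w : C) (eps : R) : 0 < eps -> exists delta, 0 < delta /\
  forall z, Cmod (z - w)%C < delta -> Cmod (A z - A w)%C < eps.
Proof.
  destruct Hdata as (_ & _ & _ & _ & HA & _). destruct (HA w) as [l Hl].
  exact (is_derive_C_continuous_eps A w l Hl eps).
Qed.

(** One bound gives both the distance to the other nodes and the growth of |z - t_n| with |t_n|, in
    the form that matches [weight]. *)
Lemma nodes_separated (w : C) : exists delta kappa, 0 < delta /\ 0 < kappa /\
  forall z, Cmod (z - w)%C < delta -> forall n, t n <> w ->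
    kappa * (1 + Cmod (t n)) <= Cmod (z - t n)%C.
Proof.
  (* For |z - w| < 1 and |t_n| > 2|w| + 3 the triangle inequality gives |z - t_n| >= (1 + |t_n|) /
     2. The finitely many remaining nodes are treated by induction. *)
  destruct (node_large (2 * Cmod w + 3)) as [n0 Hn0].
  assert (Hw := Cmod_ge_0 w).
  assert (Hfin : exists delta kappa, 0 < delta /\ 0 < kappa /\
    forall z, Cmod (z - w)%C < delta -> forall n, (n < n0)%nat -> t n <> w ->
    kappa * (1 + Cmod (t n)) <= Cmod (z - t n)%C).
  { clear Hn0. induction n0 as [|k (d & ka & Hd & Hk & H)].
    - exists 1, 1. repeat split; try lra. intros; lia.
    - destruct (classic (t k = w)) as [E|E].
      + exists d, ka. repeat split; try assumption. intros z Hz n Hn Hne.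
        apply H; [assumption| |assumption].
        destruct (Nat.eq_dec n k) as [->|]; [contradiction|lia].
      + assert (Hr := proj1 (Cmod_gt_0 _) (Csub_neq0 _ _ E)).
        set (r := Cmod (t k - w)%C) in *. assert (Htk := Cmod_ge_0 (t k)).
        exists (Rmin d (r / 2)), (Rmin ka (r / 2 / (1 + Cmod (t k)))).
        repeat split.
        * apply Rmin_glb_lt; lra.
        * apply Rmin_glb_lt; [lra|]. apply Rdiv_lt_0_compat; lra.
        * intros z Hz n Hn Hne. assert (Htn := Cmod_ge_0 (t n)).
          destruct (Nat.eq_dec n k) as [->|].
          -- apply Rle_trans with (r / 2 / (1 + Cmod (t k)) * (1 + Cmod (t k))).
             ++ apply Rmult_le_compat_r; [lra|apply Rmin_r].
             ++ unfold Rdiv at 1. rewrite Rmult_assoc, Rinv_l by lra.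
                assert (H1 := Rlt_le_trans _ _ _ Hz (Rmin_r _ _)).
                assert (H2 := Cmod_sub_ge (t k - w)%C (z - w)%C).
                replace (t k - w - (z - w))%C with (t k - z)%C in H2 by ring.
                rewrite (Cmod_minus_sym (t k) z) in H2. fold r in H2. lra.
          -- eapply Rle_trans; [|apply H; [|lia|assumption]].
             ++ apply Rmult_le_compat_r; [lra|apply Rmin_l].
             ++ exact (Rlt_le_trans _ _ _ Hz (Rmin_l _ _)). }
  destruct Hfin as (d & ka & Hd & Hk & H).
  exists (Rmin d 1), (Rmin ka (/ 2)). repeat split.
  - apply Rmin_glb_lt; lra.
  - apply Rmin_glb_lt; lra.
  - intros z Hz n Hne. assert (Htn := Cmod_ge_0 (t n)).
    destruct (Nat.lt_ge_cases n n0) as [Hl|Hl].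
    + eapply Rle_trans; [|apply H; [|exact Hl|assumption]].
      * apply Rmult_le_compat_r; [lra|apply Rmin_l].
      * exact (Rlt_le_trans _ _ _ Hz (Rmin_l _ _)).
    + apply Rle_trans with (/ 2 * (1 + Cmod (t n))).
      * apply Rmult_le_compat_r; [lra|apply Rmin_r].
      * specialize (Hn0 n Hl).
        assert (H1 := Rlt_le_trans _ _ _ Hz (Rmin_r _ _)).
        assert (H2 := Cmod_sub_ge (t n) z). rewrite Cmod_minus_sym in H2.
        assert (H3 := Cmod_sub_ge z w). lra.
Qed.

Lemma offT_near (w : C) : exists delta, 0 < delta /\
  forall z, z <> w -> Cmod (z - w)%C < delta -> offT z.
Proof.
  destruct (nodes_separated w) as (d & ka & Hd & Hk & H).
  exists d. split; [assumption|]. intros z Hzw Hz n E.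
  destruct (classic (t n = w)) as [Ew|Ew]; [congruence|].
  specialize (H z Hz n Ew). rewrite <- E in H.
  replace (z - z)%C with (RtoC 0) in H by ring. rewrite Cmod_0 in H.
  assert (H0 := Cmod_ge_0 z). nra.
Qed.

Lemma exists_near (w : C) (delta : R) : 0 < delta ->
  exists z, z <> w /\ Cmod (z - w)%C < delta.
Proof.
  intros Hd. exists (w + RtoC (delta / 2))%C.
  assert (E : (w + RtoC (delta / 2) - w)%C = RtoC (delta / 2)) by ring.
  split.
  - intros E'. rewrite E' in E. replace (w - w)%C with (RtoC 0) in E by ring.
    apply RtoC_inj in E. lra.
  - rewrite E, Cmod_R, Rabs_pos_eq; lra.
Qed.

Lemma exists_offT : exists z, offT z.
Proof.
  destruct (offT_near (RtoC 0)) as (d & Hd & H).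
  destruct (exists_near (RtoC 0) d Hd) as (z & H1 & H2). exists z. now apply H.
Qed.

Definition weight (n : nat) : R := sqrt (mu n) / (1 + Cmod (t n)).

Lemma weight_nonneg (n : nat) : 0 <= weight n.
Proof.
  assert (H := Cmod_ge_0 (t n)). apply Rmult_le_pos; [apply sqrt_pos|].
  left. apply Rinv_0_lt_compat. lra.
Qed.

(** This is where the summability of mu_n / (|t_n|^2 + 1) enters, through (1 + r)^2 >= r^2 + 1. *)
Lemma weight_l2 : l2 (fun n => RtoC (weight n)).
Proof.
  destruct Hdata as (_ & _ & Hmu & Hs & _).
  refine (ex_series_Rle _ _ _ Hs). intros n. split; [apply pow2_ge_0|].
  rewrite Cmod_R, Rabs_pos_eq by apply weight_nonneg.
  assert (H := Cmod_ge_0 (t n)). unfold weight, Rdiv.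
  rewrite Rpow_mult_distr, pow2_sqrt by (left; apply Hmu).
  apply Rmult_le_compat_l; [left; apply Hmu|].
  rewrite <- Rinv_pow by lra. apply Rinv_le_contravar; nra.
Qed.

Lemma l2_weight_summable (c : nat -> C) : l2 c ->
  ex_series (fun n => Cmod (c n) * weight n).
Proof.
  intros Hc. apply (ex_series_ext (fun n => Cmod (c n * RtoC (weight n))%C)).
  - intros n. rewrite Cmod_mult, Cmod_R, Rabs_pos_eq by apply weight_nonneg. reflexivity.
  - apply l2_prod_ex; [assumption|apply weight_l2].
Qed.

(** Terms are dominated by a multiple of |c_n| [weight n], a product of two square summable
    sequences. The hypothesis on [c] allows [w] to be a node: the term that would be singular there
    has coefficient 0. *)
Lemma cauchy_series_lipschitz (w : C) (c : nat -> C) : l2 c ->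
  (forall n, t n = w -> c n = (RtoC 0)) ->
  exists delta K Qw, 0 < delta /\ 0 <= K /\
    Cis_series (fun n => c n * s n / (w - t n))%C Qw /\
    forall z, Cmod (z - w)%C < delta -> exists Qz,
      Cis_series (fun n => c n * s n / (z - t n))%C Qz /\
      Cmod (Qz - Qw)%C <= K * Cmod (z - w)%C.
Proof.
  intros Hc Hw.
  destruct (nodes_separated w) as (d & ka & Hd & Hk & H).
  assert (Hsum := l2_weight_summable c Hc).
  assert (Hwt : forall n, Cmod (s n) = weight n * (1 + Cmod (t n))).
  { intros n. rewrite Cmod_R, Rabs_pos_eq by apply sqrt_pos. unfold weight.
    assert (H0 := Cmod_ge_0 (t n)). field. lra. }
  assert (Hterm : forall z, Cmod (z - w)%C < d -> forall n,
     Cmod (c n * s n / (z - t n))%C <= / ka * (Cmod (c n) * weight n)).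
  { intros z Hz n. assert (H0 := Cmod_ge_0 (t n)).
    assert (H0' := Cmod_ge_0 (c n)). assert (H0'' := weight_nonneg n).
    assert (Hik := Rinv_0_lt_compat _ Hk).
    destruct (classic (t n = w)) as [E|E].
    - rewrite (Hw n E). replace (0 * s n / (z - t n))%C with (RtoC 0)
        by (unfold Cdiv; ring).
      rewrite Cmod_0, Rmult_0_l, Rmult_0_r. lra.
    - specialize (H z Hz n E).
      assert (Hpos : 0 < Cmod (z - t n)%C) by nra.
      rewrite Cmod_div by (apply Cmod_gt_0; assumption).
      rewrite Cmod_mult, Hwt.
      apply Rmult_le_reg_r with (Cmod (z - t n)%C); [assumption|].
      unfold Rdiv. rewrite Rmult_assoc, Rinv_l, Rmult_1_r by lra.
      apply Rle_trans with (/ ka * (Cmod (c n) * weight n) * (ka * (1 + Cmod (t n)))).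
      + right. field. lra.
      + apply Rmult_le_compat_l; [|assumption].
        apply Rmult_le_pos; [lra|]. now apply Rmult_le_pos. }
  assert (Hex : forall z, Cmod (z - w)%C < d -> exists Qz,
     Cis_series (fun n => c n * s n / (z - t n))%C Qz).
  { intros z Hz. apply Cex_series_abs.
    apply (ex_series_Rle _ (fun n => / ka * (Cmod (c n) * weight n))).
    - intros n. split; [apply Cmod_ge_0|now apply Hterm].
    - apply (ex_series_scal (K := R_AbsRing) (V := R_NormedModule) (/ ka)). assumption. }
  assert (Hww : Cmod (w - w)%C < d).
  { replace (w - w)%C with (RtoC 0) by ring. now rewrite Cmod_0. }
  destruct (Hex w Hww) as [Qw HQw].
  (* The difference of two terms is (w - z) / (z - t_n) times the term at [w]; the fraction 1 / (z -
     t_n) and the term at [w] each cost a factor [/ ka]. *)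
  set (K := / ka * (/ ka * Series (fun n => Cmod (c n) * weight n))).
  assert (HS : 0 <= Series (fun n => Cmod (c n) * weight n)).
  { apply Series_nonneg; [|assumption]. intros n.
    apply Rmult_le_pos; [apply Cmod_ge_0|apply weight_nonneg]. }
  assert (Hik := Rinv_0_lt_compat _ Hk).
  exists d, K, Qw. split; [assumption|]. split; [|split; [assumption|]].
  { unfold K. apply Rmult_le_pos; [lra|]. apply Rmult_le_pos; lra. }
  intros z Hz. destruct (Hex z Hz) as [Qz HQz]. exists Qz. split; [assumption|].
  assert (Hdiff := Cis_series_minus _ _ _ _ HQz HQw).
  assert (Hdb : forall n, 0 <= Cmod (c n * s n / (z - t n) - c n * s n / (w - t n))%C
     <= Cmod (z - w)%C * / ka * / ka * (Cmod (c n) * weight n)).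
  { intros n. split; [apply Cmod_ge_0|].
    assert (H0 := Cmod_ge_0 (t n)).
    destruct (classic (t n = w)) as [E|E].
    - rewrite (Hw n E). replace (0 * s n / (z - t n) - 0 * s n / (w - t n))%C with (RtoC 0)
        by (unfold Cdiv; ring).
      rewrite Cmod_0, Rmult_0_l, Rmult_0_r. lra.
    - assert (H1 := H z Hz n E). assert (H2 := H w Hww n E).
      assert (Hp1 : 0 < Cmod (z - t n)%C) by nra.
      assert (Hp2 : 0 < Cmod (w - t n)%C) by nra.
      assert (Hn1 := proj2 (Cmod_gt_0 _) Hp1). assert (Hn2 := proj2 (Cmod_gt_0 _) Hp2).
      replace (c n * s n / (z - t n) - c n * s n / (w - t n))%C
        with ((w - z) * (/ (z - t n)) * (c n * s n / (w - t n)))%C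
        by (field; split; assumption).
      rewrite !Cmod_mult, Cmod_inv, (Cmod_minus_sym w z) by assumption.
      rewrite !Rmult_assoc.
      apply Rmult_le_compat_l; [apply Cmod_ge_0|].
      apply Rmult_le_compat; [left; now apply Rinv_0_lt_compat|apply Cmod_ge_0| |].
      + apply Rinv_le_contravar; [assumption|]. nra.
      + now apply Hterm. }
  assert (Hdex : ex_series (fun n =>
     Cmod (z - w)%C * / ka * / ka * (Cmod (c n) * weight n)))
    by (apply (ex_series_scal (K := R_AbsRing) (V := R_NormedModule)); assumption).
  eapply Rle_trans.
  { apply (Cmod_series_le _ _ Hdiff). exact (ex_series_Rle _ _ Hdb Hdex). }
  eapply Rle_trans; [apply (Series_le _ _ Hdb Hdex)|].
  rewrite Series_scal_l. unfold K. right. ring.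
Qed.

(** At a node the value is prescribed as the limit of A(z) times the series: the derivative of A
    times the residue of the series. *)
Definition is_val (c : nat -> C) (z v : C) : Prop :=
  (offT z /\ exists S, Cis_series (fun n => c n * s n / (z - t n))%C S /\ v = (A z * S)%C) \/
  (exists m, z = t m /\ v = (dA m * (c m * s m))%C).

Lemma is_val_ex (c : nat -> C) (z : C) : l2 c -> exists v, is_val c z v.
Proof.
  intros Hc. destruct (classic (exists m, z = t m)) as [[m Hm]|Hn].
  - exists (dA m * (c m * s m))%C. right. now exists m.
  - assert (Hoff : offT z) by (intros n E; apply Hn; now exists n).
    destruct (cauchy_series_lipschitz z c Hc) as (d & K & Q & _ & _ & HQ & _).
    { intros n E. now contradiction (Hoff n). }
    exists (A z * Q)%C. left. split; [assumption|]. now exists Q.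
Qed.

Lemma is_val_unique (c : nat -> C) (z v v' : C) : is_val c z v -> is_val c z v' -> v = v'.
Proof.
  intros [(H & S & HS & ->)|(m & Hm & ->)] [(H' & S' & HS' & ->)|(m' & Hm' & ->)].
  - now rewrite (Cis_series_unique _ _ _ HS HS').
  - now contradiction (H m').
  - now contradiction (H' m).
  - assert (m = m') by (apply node_inj; congruence). now subst m'.
Qed.

Lemma drop_index_l2 (m : nat) (c : nat -> C) : l2 c -> l2 (drop_index m c).
Proof.
  apply l2_le. intros n. unfold drop_index. destruct (Nat.eqb n m).
  - rewrite Cmod_0. apply Cmod_ge_0.
  - apply Rle_refl.
Qed.

(* Near a node [t m] the simple zero of [A] cancels the only singular term of the series. *)
Lemma is_val_limit (c : nat -> C) (w v : C) (eps : R) : l2 c -> is_val c w v -> 0 < eps ->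
  exists delta, 0 < delta /\ forall z, z <> w -> Cmod (z - w)%C < delta ->
    offT z /\ exists S, Cis_series (fun n => c n * s n / (z - t n))%C S /\
      Cmod (A z * S - v)%C < eps.
Proof.
  intros Hc Hv Heps.
  destruct (offT_near w) as (d0 & Hd0 & Hoff).
  destruct Hv as [(Hw & S0 & HS0 & ->)|(m & -> & ->)].
  - destruct (cauchy_series_lipschitz w c Hc) as (d & K & Q & Hd & HK & HQ & H).
    { intros n E. now contradiction (Hw n). }
    assert (S0 = Q) by (eapply Cis_series_unique; eassumption). subst Q.
    assert (HS0' := Cmod_ge_0 S0). assert (HAw := Cmod_ge_0 (A w)).
    set (e := Rmin 1 (eps / (Cmod S0 + 1 + Cmod (A w)) / 2)).
    assert (Hq : 0 < eps / (Cmod S0 + 1 + Cmod (A w)) / 2)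
      by (apply Rdiv_lt_0_compat; [apply Rdiv_lt_0_compat; lra|lra]).
    assert (He : 0 < e) by (apply Rmin_glb_lt; lra).
    destruct (A_continuous_eps w e He) as (d1 & Hd1 & HA).
    exists (Rmin d0 (Rmin d (Rmin d1 (e / (K + 1))))). split.
    { repeat apply Rmin_glb_lt; try assumption. apply Rdiv_lt_0_compat; lra. }
    intros z Hzw Hz.
    assert (Z0 := Rlt_le_trans _ _ _ Hz (Rmin_l _ _)).
    assert (Z' := Rlt_le_trans _ _ _ Hz (Rmin_r _ _)).
    assert (Z1 := Rlt_le_trans _ _ _ Z' (Rmin_l _ _)).
    assert (Z'' := Rlt_le_trans _ _ _ Z' (Rmin_r _ _)).
    assert (Z2 := Rlt_le_trans _ _ _ Z'' (Rmin_l _ _)).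
    assert (Z3 := Rlt_le_trans _ _ _ Z'' (Rmin_r _ _)).
    split; [now apply Hoff|].
    destruct (H z Z1) as (Sz & HSz & HL). exists Sz. split; [assumption|].
    specialize (HA z Z2).
    assert (HSe : Cmod (Sz - S0)%C < e).
    { eapply Rle_lt_trans; [exact HL|].
      assert (H1 := Cmod_ge_0 (z - w)%C).
      apply Rle_lt_trans with ((K + 1) * Cmod (z - w)%C); [nra|].
      apply Rlt_le_trans with ((K + 1) * (e / (K + 1))); [|right; field; lra].
      apply Rmult_lt_compat_l; lra. }
    replace (A z * Sz - A w * S0)%C
      with ((A z - A w) * (Sz - S0) + ((A z - A w) * S0 + A w * (Sz - S0)))%C by ring.
    eapply Rle_lt_trans; [apply Cmod_triangle|].
    eapply Rle_lt_trans; [apply Rplus_le_compat_l, Cmod_triangle|].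
    rewrite !Cmod_mult.
    assert (He1 : e <= 1) by apply Rmin_l.
    assert (He2 : e <= eps / (Cmod S0 + 1 + Cmod (A w)) / 2) by apply Rmin_r.
    assert (X1 := Cmod_ge_0 (A z - A w)%C). assert (X2 := Cmod_ge_0 (Sz - S0)%C).
    apply Rle_lt_trans with (e * (Cmod S0 + 1 + Cmod (A w))); [nra|].
    apply Rle_lt_trans with
      (eps / (Cmod S0 + 1 + Cmod (A w)) / 2 * (Cmod S0 + 1 + Cmod (A w))); [nra|].
    replace (eps / (Cmod S0 + 1 + Cmod (A w)) / 2 * (Cmod S0 + 1 + Cmod (A w)))
      with (eps / 2) by (field; lra). lra.
  - destruct (cauchy_series_lipschitz (t m) (drop_index m c)) as (d & K & Q & Hd & HK & HQ & H).
    { now apply drop_index_l2. }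
    { intros n E. apply node_inj in E. subst n. unfold drop_index. now rewrite Nat.eqb_refl. }
    assert (HQ0 := Cmod_ge_0 Q). assert (Hcs := Cmod_ge_0 (c m * s m)%C).
    set (M := Cmod Q + 1 + Cmod (c m * s m)%C).
    assert (HM : 0 < M) by (unfold M; lra).
    set (e := eps / M / 2).
    assert (He : 0 < e) by (unfold e; repeat apply Rdiv_lt_0_compat; lra).
    destruct (A_continuous_eps (t m) e He) as (d1 & Hd1 & HA).
    destruct (is_derive_C_eps _ _ _ (is_derive_dA m) e He) as (d2 & Hd2 & HD).
    exists (Rmin d0 (Rmin d (Rmin d1 (Rmin d2 (/ (K + 1)))))). split.
    { repeat apply Rmin_glb_lt; try assumption. apply Rinv_0_lt_compat; lra. }
    intros z Hzw Hz.
    assert (Z0 := Rlt_le_trans _ _ _ Hz (Rmin_l _ _)).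
    assert (Z' := Rlt_le_trans _ _ _ Hz (Rmin_r _ _)).
    assert (Z1 := Rlt_le_trans _ _ _ Z' (Rmin_l _ _)).
    assert (Z'' := Rlt_le_trans _ _ _ Z' (Rmin_r _ _)).
    assert (Z2 := Rlt_le_trans _ _ _ Z'' (Rmin_l _ _)).
    assert (Z3 := Rlt_le_trans _ _ _ Z'' (Rmin_r _ _)).
    assert (Z4 := Rlt_le_trans _ _ _ Z3 (Rmin_l _ _)).
    assert (Z5 := Rlt_le_trans _ _ _ Z3 (Rmin_r _ _)).
    split; [now apply Hoff|].
    destruct (H z Z1) as (Qz & HQz & HL).
    exists (Qz + c m * s m / (z - t m))%C. split.
    { apply (Cis_series_drop m (fun n => c n * s n / (z - t n))%C).
      refine (Cis_series_ext _ _ _ _ HQz). intros n. unfold drop_index.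
      destruct (Nat.eqb n m); [unfold Cdiv; ring|reflexivity]. }
    specialize (HA z Z2). specialize (HD z Z4). rewrite A_node in HA, HD.
    assert (Hne := Csub_neq0 _ _ Hzw).
    assert (Hpos := proj1 (Cmod_gt_0 _) Hne).
    assert (HQz1 : Cmod Qz <= Cmod Q + 1).
    { replace Qz with (Qz - Q + Q)%C by ring.
      eapply Rle_trans; [apply Cmod_triangle|].
      enough (K * Cmod (z - t m)%C <= 1) by lra.
      apply Rle_trans with ((K + 1) * / (K + 1)); [nra|].
      rewrite Rinv_r; lra. }
    (* [Qz] collects the terms away from the node; the singular term turns A into its difference
       quotient, which is within [e] of [dA m]. The total error is at most [e * M]. *)
    replace (A z * (Qz + c m * s m / (z - t m)) - dA m * (c m * s m))%C
      with ((A z - 0) * Qz + (A z - 0 - (z - t m) * dA m) / (z - t m) * (c m * s m))%C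
      by (field; assumption).
    eapply Rle_lt_trans; [apply Cmod_triangle|].
    rewrite !(Cmod_mult _ Qz), (Cmod_mult _ (c m * s m)), Cmod_div by assumption.
    assert (HD' : Cmod (A z - 0 - (z - t m) * dA m)%C / Cmod (z - t m)%C <= e).
    { apply Rmult_le_reg_r with (Cmod (z - t m)%C); [assumption|].
      unfold Rdiv. rewrite Rmult_assoc, Rinv_l by lra. lra. }
    assert (X1 := Cmod_ge_0 Qz). assert (X2 := Cmod_ge_0 (A z - 0)%C).
    apply Rle_lt_trans with (e * M).
    + unfold M. rewrite Rmult_plus_distr_l.
      apply Rplus_le_compat.
      * apply Rmult_le_compat; lra.
      * apply Rmult_le_compat_r; lra.
    + unfold e. replace (eps / M / 2 * M) with (eps / 2) by (field; lra). lra.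
Qed.

(** Both directions come from [is_val_limit]: it is the continuity of the function with the
    prescribed values, and conversely uniqueness of limits pins down a continuous [F] at each
    node. *)
Lemma rep_is_val (c : nat -> C) (F : C -> C) : l2 c ->
  rep t mu A c F <-> forall z, is_val c z (F z).
Proof.
  intros Hc. split.
  - intros [Hcont HF] z.
    destruct (classic (exists m, z = t m)) as [[m ->]|Hn].
    + right. exists m. split; [reflexivity|].
      set (v := (dA m * (c m * s m))%C).
      assert (Hv : is_val c (t m) v) by (right; exists m; split; reflexivity).
      apply Cmod_lt_eps_eq. intros eps Heps.
      assert (He : 0 < eps / 2) by lra.
      destruct (is_val_limit c (t m) v (eps / 2) Hc Hv He) as (d & Hd & H).
      destruct (proj1 (continuous_C_eps F (t m)) (Hcont _) (eps / 2) He) as (d' & Hd' & H').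
      destruct (exists_near (t m) (Rmin d d')) as (y & Hy1 & Hy2);
        [now apply Rmin_glb_lt|].
      destruct (H y Hy1 (Rlt_le_trans _ _ _ Hy2 (Rmin_l _ _))) as (Hoff & S & HS & HSv).
      specialize (H' y (Rlt_le_trans _ _ _ Hy2 (Rmin_r _ _))).
      destruct (HF y Hoff) as (S' & HS' & E).
      assert (S' = S) by (eapply Cis_series_unique; eassumption). subst S'.
      rewrite E in H'.
      replace (F (t m) - v)%C with ((A y * S - v) - (A y * S - F (t m)))%C by ring.
      eapply Rle_lt_trans; [apply Cmod_triangle_minus|]. lra.
    + left. assert (Hoff : offT z) by (intros n E; apply Hn; now exists n).
      split; [assumption|]. exact (HF z Hoff).
  - intros HF. split.
    + intros w. apply continuous_C_eps. intros eps Heps.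
      destruct (is_val_limit c w _ eps Hc (HF w) Heps) as (d & Hd & H).
      exists d. split; [assumption|]. intros y Hy.
      destruct (classic (y = w)) as [->|Hne].
      { replace (F w - F w)%C with (RtoC 0) by ring. now rewrite Cmod_0. }
      destruct (H y Hne Hy) as (Hoff & S & HS & Hlt).
      replace (F y) with (A y * S)%C; [assumption|].
      apply (is_val_unique c y); [|apply HF]. left. split; [assumption|]. now exists S.
    + intros z Hz. destruct (HF z) as [(_ & H)|(m & E & _)]; [exact H|].
      now contradiction (Hz m).
Qed.

Lemma rep_ex (c : nat -> C) : l2 c -> exists F, rep t mu A c F.
Proof.
  intros Hc.
  exists (fun z => proj1_sig (constructive_indefinite_description _ (is_val_ex c z Hc))).
  apply rep_is_val; [assumption|]. intros z.
  exact (proj2_sig (constructive_indefinite_description _ (is_val_ex c z Hc))).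
Qed.

Lemma rep_node (c : nat -> C) (F : C -> C) (m : nat) : l2 c -> rep t mu A c F ->
  F (t m) = (dA m * (c m * s m))%C.
Proof.
  intros Hc HF. apply (is_val_unique c (t m)); [now apply rep_is_val|].
  right. now exists m.
Qed.

(** The values at the nodes recover the coefficients, since A'(t_m) and mu_m are nonzero. Hence the
    sequences hidden in existential definitions such as [InH] and [convH] can be identified with
    each other. *)
Lemma rep_coef_unique (c d : nat -> C) (F : C -> C) : l2 c -> l2 d ->
  rep t mu A c F -> rep t mu A d F -> c = d.
Proof.
  intros Hc Hd H1 H2. apply functional_extensionality. intros m.
  assert (E1 := rep_node c F m Hc H1). rewrite (rep_node d F m Hd H2) in E1.
  assert (Ha := dA_neq0 m). assert (Hs := sqrt_mu_neq0 m).
  replace (c m) with (/ (dA m * s m) * (dA m * (c m * s m)))%C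
    by (field; split; assumption).
  rewrite <- E1. field. split; assumption.
Qed.

Lemma rep_plus (c d : nat -> C) (F G : C -> C) :
  rep t mu A c F -> rep t mu A d G ->
  rep t mu A (fun n => c n + d n)%C (fun z => F z + G z)%C.
Proof.
  intros [HF1 HF2] [HG1 HG2]. split.
  - intros z. apply (continuous_plus (K := C_AbsRing) (V := C_NormedModule) F G); auto.
  - intros z Hz. destruct (HF2 z Hz) as (S & HS & ->). destruct (HG2 z Hz) as (S' & HS' & ->).
    exists (S + S')%C. split; [|ring].
    refine (Cis_series_ext _ _ _ _ (Cis_series_plus _ _ _ _ HS HS')).
    intros n. simpl. unfold Cdiv. ring.
Qed.

Lemma rep_scal (a : C) (c : nat -> C) (F : C -> C) :
  rep t mu A c F -> rep t mu A (fun n => a * c n)%C (fun z => a * F z)%C.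
Proof.
  intros [HF1 HF2]. split.
  - intros z.
    apply (continuous_comp F (fun y => (a * y)%C)); [apply HF1|].
    apply (filterlim_scal_r (K := C_AbsRing) (V := C_NormedModule) a (F z)).
  - intros z Hz. destruct (HF2 z Hz) as (S & HS & ->).
    exists (a * S)%C. split; [|ring].
    refine (Cis_series_ext _ _ _ _ (Cis_series_scal a _ _ HS)).
    intros n. simpl. unfold Cdiv. ring.
Qed.

Lemma rep_zero : rep t mu A (fun _ => (RtoC 0)) (fun _ => (RtoC 0)).
Proof.
  split.
  - intros z. apply continuous_const.
  - intros z _. exists (RtoC 0). split; [|ring].
    refine (Cis_series_ext _ _ _ _ (Cis_series_single 0 (RtoC 0))).
    intros n. simpl. destruct (Nat.eqb n 0); unfold Cdiv; ring.
Qed.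

Lemma l2_zero : l2 (fun _ => (RtoC 0)).
Proof. apply fin_supp_l2. exists 0%nat. reflexivity. Qed.

(** Evaluation at the nodes relates the coefficients. Off the nodes, (z - w) d_n / (z - t_n) - c_n /
    (z - t_n) = d_n, so the sum of d_n mu_n^(1/2) is (z - w) S' - S, which is 0 at any point where A
    does not vanish. *)
Lemma division_coefs (w : C) (c d : nat -> C) (f g : C -> C) : l2 c -> l2 d ->
  rep t mu A c f -> rep t mu A d g -> (forall z, f z = (z - w) * g z)%C ->
  (forall n, c n = (t n - w) * d n)%C /\ Cis_series (fun n => d n * s n)%C (RtoC 0).
Proof.
  intros Hc Hd Hf Hg E.
  assert (Ec : forall n, c n = ((t n - w) * d n)%C).
  { intros m. assert (E1 := E (t m)).
    rewrite (rep_node c f m Hc Hf), (rep_node d g m Hd Hg) in E1.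
    assert (Ha := dA_neq0 m). assert (Hs := sqrt_mu_neq0 m).
    replace (c m) with (/ (dA m * s m) * (dA m * (c m * s m)))%C
      by (field; split; assumption).
    rewrite E1. field. split; assumption. }
  split; [assumption|].
  destruct exists_offT as [z Hz].
  destruct (proj2 Hf z Hz) as (S & HS & ES). destruct (proj2 Hg z Hz) as (S' & HS' & ES').
  assert (E1 := E z). rewrite ES, ES' in E1.
  assert (HA := A_offT z Hz).
  assert (E2 : S = ((z - w) * S')%C).
  { replace S with (/ A z * (A z * S))%C by (field; assumption).
    rewrite E1. field. assumption. }
  replace (RtoC 0) with ((z - w) * S' - S)%C by (rewrite E2; ring).
  refine (Cis_series_ext _ _ _ _
    (Cis_series_minus _ _ _ _ (Cis_series_scal (z - w)%C _ _ HS') HS)).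
  intros n. simpl. rewrite Ec.
  assert (Hne := Csub_neq0 _ _ (Hz n)). field. assumption.
Qed.

Lemma division_rep (w : C) (c d : nat -> C) (f g : C -> C) : l2 c -> l2 d ->
  rep t mu A c f -> rep t mu A d g ->
  (forall n, c n = (t n - w) * d n)%C -> Cis_series (fun n => d n * s n)%C (RtoC 0) ->
  forall z, (f z = (z - w) * g z)%C.
Proof.
  intros Hc Hd Hf Hg Ec H0 z.
  destruct (classic (exists m, z = t m)) as [[m ->]|Hn].
  - rewrite (rep_node c f m Hc Hf), (rep_node d g m Hd Hg), Ec. ring.
  - assert (Hoff : offT z) by (intros n E; apply Hn; now exists n).
    destruct (proj2 Hf z Hoff) as (S & HS & ->). destruct (proj2 Hg z Hoff) as (S' & HS' & ->).
    enough (E : S = ((z - w) * S' - 0)%C) by (rewrite E; ring).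
    refine (Cis_series_unique _ _ _ HS _).
    refine (Cis_series_ext _ _ _ _
      (Cis_series_minus _ _ _ _ (Cis_series_scal (z - w)%C _ _ HS') H0)).
    intros n. simpl. rewrite Ec.
    assert (Hne := Csub_neq0 _ _ (Hoff n)). field. assumption.
Qed.

(** Off the nodes, f(w) = 0 says precisely that c_n / (t_n - w) has vanishing moment of order 0. At
    a node t_m it only says c_m = 0, but then d_m is free and can be chosen to make that moment
    vanish. *)
Lemma division_ex (w : C) (c : nat -> C) (f : C -> C) : l2 c -> rep t mu A c f ->
  f w = (RtoC 0) -> exists d, l2 d /\ (forall n, c n = (t n - w) * d n)%C /\
    Cis_series (fun n => d n * s n)%C (RtoC 0).
Proof.
  intros Hc Hf Hw.
  destruct (nodes_separated w) as (d0 & ka & Hd0 & Hk & Hsep).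
  assert (Hww : Cmod (w - w)%C < d0).
  { replace (w - w)%C with (RtoC 0) by ring. now rewrite Cmod_0. }
  assert (Hquot : l2 (fun n => if excluded_middle_informative (t n = w) then RtoC 0
                               else (c n / (t n - w))%C)).
  { apply (l2_le _ (fun n => RtoC (/ ka) * c n)%C); [|now apply l2_scal].
    intros n. assert (Hik := Rinv_0_lt_compat _ Hk).
    destruct (excluded_middle_informative (t n = w)) as [E|E].
    - rewrite Cmod_0. apply Cmod_ge_0.
    - assert (Hne := Csub_neq0 _ _ E).
      assert (H1 := Hsep w Hww n E). rewrite Cmod_minus_sym in H1.
      assert (H2 := Cmod_ge_0 (t n)).
      rewrite Cmod_mult, Cmod_R, Rabs_pos_eq, Cmod_div by (assumption || lra).
      unfold Rdiv. rewrite Rmult_comm. apply Rmult_le_compat_r; [apply Cmod_ge_0|].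
      apply Rinv_le_contravar; [assumption|]. nra. }
  destruct (classic (exists m, w = t m)) as [[m Hm]|Hn].
  - assert (Ecm : c m = (RtoC 0)).
    { assert (E := rep_node c f m Hc Hf). rewrite <- Hm, Hw in E.
      assert (Ha := dA_neq0 m). assert (Hs := sqrt_mu_neq0 m).
      replace (c m) with (/ (dA m * s m) * (dA m * (c m * s m)))%C
        by (field; split; assumption).
      rewrite <- E. ring. }
    destruct (cauchy_series_lipschitz w c Hc) as (_ & _ & Q & _ & _ & HQ & _).
    { intros n E. rewrite Hm in E. apply node_inj in E. now subst n. }
    (* [Q] is formed with w - t_n, so the entries other than [m] contribute -Q; the entry at [m]
       compensates. *)
    exists (fun n => if Nat.eqb n m then (Q / s m)%C else
                if excluded_middle_informative (t n = w) then RtoC 0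
                else (c n / (t n - w))%C).
    assert (Hs := sqrt_mu_neq0 m).
    split; [|split].
    + apply (l2_le _ (fun n => (if Nat.eqb n m then (Q / s m)%C else RtoC 0) +
                       (if excluded_middle_informative (t n = w) then RtoC 0
                        else (c n / (t n - w))%C))%C).
      * intros n. destruct (Nat.eqb_spec n m) as [->|].
        -- destruct (excluded_middle_informative (t m = w)); [|congruence].
           right. f_equal. ring.
        -- right. f_equal. ring.
      * apply l2_plus; [|assumption]. apply fin_supp_l2. exists (S m). intros n Hn.
        destruct (Nat.eqb_spec n m); [lia|reflexivity].
    + intros n. destruct (Nat.eqb_spec n m) as [->|Hne].
      * rewrite Ecm, <- Hm. ring.
      * destruct (excluded_middle_informative (t n = w)) as [E|E].
        { rewrite Hm in E. now apply node_inj in E. }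
        assert (H0 := Csub_neq0 _ _ E). field. assumption.
    + match goal with |- is_series ?u _ => set (d := u) end.
      replace (RtoC 0) with (RtoC (-1) * Q + d m)%C.
      * apply Cis_series_drop.
        refine (Cis_series_ext _ _ _ _ (Cis_series_scal (RtoC (-1)) _ _ HQ)).
        intros n. simpl. unfold drop_index, d. destruct (Nat.eqb_spec n m) as [->|Hne].
        -- rewrite Ecm. unfold Cdiv. ring.
        -- destruct (excluded_middle_informative (t n = w)) as [E|E].
           { rewrite Hm in E. now apply node_inj in E. }
           assert (H0 := Csub_neq0 _ _ E).
           assert (H0' := Csub_neq0 _ _ (not_eq_sym E)).
           field. split; assumption.
      * unfold d. rewrite Nat.eqb_refl. field. assumption.
  - assert (Hoff : offT w) by (intros n E; apply Hn; now exists n).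
    destruct (proj2 Hf w Hoff) as (S & HS & E). rewrite Hw in E.
    assert (ES : S = (RtoC 0)).
    { assert (HA := A_offT w Hoff). replace S with (/ A w * (A w * S))%C by (field; assumption).
      rewrite <- E. ring. }
    rewrite ES in HS.
    eexists. split; [exact Hquot|]. split.
    + intros n. simpl. destruct (excluded_middle_informative (t n = w)) as [E'|E'].
      { now contradiction (Hoff n). }
      assert (H0 := Csub_neq0 _ _ E'). field. assumption.
    + replace (RtoC 0) with (RtoC (-1) * RtoC 0)%C by ring.
      refine (Cis_series_ext _ _ _ _ (Cis_series_scal (RtoC (-1)) _ _ HS)).
      intros n. simpl. destruct (excluded_middle_informative (t n = w)) as [E'|E'].
      { now contradiction (Hoff n). }
      assert (H0 := Csub_neq0 _ _ E'). assert (H0' := Csub_neq0 _ _ (not_eq_sym E')).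
      field. split; assumption.
Qed.

Lemma InH_nearly_invariant : nearly_invariant (InH t mu A).
Proof.
  intros f w (c & Hc & Hf) Hw.
  destruct (division_ex w c f Hc Hf Hw) as (d & Hd & Ec & H0).
  destruct (rep_ex d Hd) as [g Hg]. exists g. split.
  - now exists d.
  - now apply (division_rep w c d).
Qed.

(** * Moments *)

(** A relation rather than a function, because the series may diverge for a square summable [c]. *)
Definition moment (j : nat) (c : nat -> C) (v : C) : Prop :=
  Cis_series (fun n => pow_n (t n) j * c n * s n)%C v.

Lemma moment_unique (j : nat) (c : nat -> C) (v v' : C) :
  moment j c v -> moment j c v' -> v = v'.
Proof. apply Cis_series_unique. Qed.

Lemma moment_plus (j : nat) (c d : nat -> C) (v v' : C) :
  moment j c v -> moment j d v' -> moment j (fun n => c n + d n)%C (v + v')%C.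
Proof.
  intros H H'. refine (Cis_series_ext _ _ _ _ (Cis_series_plus _ _ _ _ H H')).
  intros n. simpl. ring.
Qed.

Lemma moment_scal (j : nat) (a : C) (c : nat -> C) (v : C) :
  moment j c v -> moment j (fun n => a * c n)%C (a * v)%C.
Proof.
  intros H. refine (Cis_series_ext _ _ _ _ (Cis_series_scal a _ _ H)).
  intros n. simpl. ring.
Qed.

Lemma moment_minus (j : nat) (c d : nat -> C) (v v' : C) :
  moment j c v -> moment j d v' -> moment j (fun n => c n - d n)%C (v - v')%C.
Proof.
  intros H H'. refine (Cis_series_ext _ _ _ _ (Cis_series_minus _ _ _ _ H H')).
  intros n. simpl. ring.
Qed.

Lemma moment_fin (j : nat) (c : nat -> C) : fin_supp c -> exists v, moment j c v.
Proof.
  intros [k Hk]. apply Cis_series_fin. exists k. intros n Hn. rewrite (Hk n Hn). ring.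
Qed.

(** The entrywise conjugate of [Bcoef t mu j]: the moment of order [j] is the bilinear pairing with
    it, and is continuous once it is square summable. *)
Definition bvec (j n : nat) : C := (pow_n (t n) j * s n)%C.

Lemma moment_l2 (j : nat) (c : nat -> C) : l2 (bvec j) -> l2 c -> exists v, moment j c v.
Proof.
  intros Hb Hc. apply Cex_series_abs.
  apply (ex_series_ext (fun n => Cmod (c n * bvec j n)%C)).
  - intros n. apply f_equal. unfold bvec. ring.
  - now apply l2_prod_ex.
Qed.

Lemma Cmod_bvec (j n : nat) : Cmod (bvec j n) ^ 2 = Cmod (t n) ^ (2 * j) * mu n.
Proof.
  destruct Hdata as (_ & _ & Hmu & _).
  unfold bvec. rewrite Cmod_mult, Cmod_pow_n, Cmod_R, Rabs_pos_eq by apply sqrt_pos.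
  rewrite Rpow_mult_distr, pow2_sqrt by (left; apply Hmu).
  now rewrite <- pow_mult, Nat.mul_comm.
Qed.

(** The classical divided difference at t_0, ..., t_N: E_n mu_n^(1/2) is the inverse of the product
    of t_n - t_k over k <> n. It kills polynomials of degree below N and sends z^N to 1. *)
Lemma divided_difference (N : nat) : exists E,
  (forall n, (N < n)%nat -> E n = (RtoC 0)) /\
  (forall i, (i < N)%nat -> moment i E (RtoC 0)) /\ moment N E (RtoC 1).
Proof.
  induction N as [|N (E & Hfin & H0 & H1)].
  - exists (fun n => if Nat.eqb n 0 then (/ s 0%nat)%C else RtoC 0). split; [|split].
    + intros n Hn. destruct (Nat.eqb_spec n 0); [lia|reflexivity].
    + intros; lia.
    + refine (Cis_series_ext _ _ _ _ (Cis_series_single 0 (RtoC 1))).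
      intros n. simpl. destruct (Nat.eqb_spec n 0) as [->|]; [|ring].
      assert (Hs := sqrt_mu_neq0 0). change (RtoC 1 = 1 * / s 0%nat * s 0%nat)%C.
      field. assumption.
  - set (w := t (S N)).
    destruct (Cis_series_fin (fun n => E n * s n / (t n - w))%C) as [Q HQ].
    { exists (S N). intros n Hn. rewrite (Hfin n) by lia. unfold Cdiv. ring. }
    assert (Hs := sqrt_mu_neq0 (S N)).
    (* Passing to the new node [w] divides the old entries by t_n - w; the new entry makes the
       moment of order 0 vanish. The other moments follow from t^(i+1) = (t - w) t^i + w t^i. *)
    set (E' := fun n => if Nat.eqb n (S N) then (- Q / s (S N))%C else (E n / (t n - w))%C).
    assert (HE : forall n, ((t n - w) * E' n)%C = E n).
    { intros n. unfold E'. destruct (Nat.eqb_spec n (S N)) as [->|Hne].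
      - rewrite (Hfin (S N)) by lia. unfold w. ring.
      - assert (Hnw : t n <> w) by (intros E0; apply Hne; now apply node_inj).
        assert (H := Csub_neq0 _ _ Hnw). field. assumption. }
    assert (M0 : moment 0 E' (RtoC 0)).
    { unfold moment. set (u := fun n => (pow_n (t n) 0 * E' n * s n)%C).
      replace (RtoC 0) with (Q + u (S N))%C.
      - apply Cis_series_drop. refine (Cis_series_ext _ _ _ _ HQ).
        intros n. unfold drop_index, u, E'.
        destruct (Nat.eqb_spec n (S N)) as [->|Hne].
        + rewrite (Hfin (S N)) by lia. unfold Cdiv. ring.
        + change (E n * s n / (t n - w) = 1 * (E n / (t n - w)) * s n)%C.
          unfold Cdiv. ring.
      - unfold u, E'. rewrite Nat.eqb_refl.
        change (Q + 1 * (- Q / s (S N)) * s (S N) = 0)%C. field. assumption. }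
    assert (Mstep : forall i v v', moment i E v -> moment i E' v' ->
              moment (S i) E' (v + w * v')%C).
    { intros i v v' H H'.
      refine (Cis_series_ext _ _ _ _ (Cis_series_plus _ _ _ _ H (Cis_series_scal w _ _ H'))).
      intros n. simpl. rewrite <- HE.
      change (pow_n (t n) i * ((t n - w) * E' n) * s n + w * (pow_n (t n) i * E' n * s n) =
        t n * pow_n (t n) i * E' n * s n)%C. ring. }
    assert (Mz : forall i, (i <= N)%nat -> moment i E' (RtoC 0)).
    { induction i as [|i IH]; intros Hi; [assumption|].
      replace (RtoC 0) with (0 + w * 0)%C by ring.
      apply Mstep; [apply H0; lia|apply IH; lia]. }
    exists E'. split; [|split].
    + intros n Hn. unfold E'. destruct (Nat.eqb_spec n (S N)); [lia|].
      rewrite (Hfin n) by lia. unfold Cdiv. ring.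
    + intros i Hi. apply Mz. lia.
    + replace (RtoC 1) with (1 + w * 0)%C by ring.
      apply Mstep; [assumption|now apply Mz].
Qed.

Lemma divided_difference_fin (N : nat) : exists E, fin_supp E /\
  (forall i, (i < N)%nat -> moment i E (RtoC 0)) /\ moment N E (RtoC 1).
Proof.
  destruct (divided_difference N) as (E & H & H').
  exists E. split; [|assumption]. exists (S N). intros n Hn. apply H. lia.
Qed.

Lemma Csum_n_RtoC (g : nat -> R) (k : nat) :
  Csum_n (fun n => RtoC (g n)) k = RtoC (sum_n g k).
Proof.
  induction k as [|k IH].
  - now rewrite !sum_O.
  - rewrite !sum_Sn, IH. symmetry. apply RtoC_plus.
Qed.

Lemma sum_n_bounded_ex_series (a : nat -> R) (M : R) : (forall n, 0 <= a n) ->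
  (forall n, sum_n a n <= M) -> ex_series a.
Proof.
  intros Ha HM.
  apply (ex_finite_lim_seq_incr (sum_n a) M); [|assumption].
  intros n. rewrite sum_Sn. unfold plus; simpl. specialize (Ha (S n)). lra.
Qed.

(* Truncations of the conjugate of [bvec N] to far away nodes, normalised so that the
   moment of order [N] is 1: the lower moments carry an extra power of [1 / |t_n|]. *)
Lemma almost_dual_vector (N : nat) (eps : R) : ~ l2 (bvec N) -> 0 < eps ->
  exists f, fin_supp f /\ nrm2 f < eps /\ moment N f (RtoC 1) /\
    forall i, (i < N)%nat -> exists v, moment i f v /\ Cmod v < eps.
Proof.
  intros Hb Heps.
  (* [R0] serves twice: nodes beyond it gain a factor 1 / |t_n| < [eps] in the lower moments, and a
     partial sum [Sg] beyond it makes the squared norm [/ Sg] of [f] less than [eps]. *)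
  set (R0 := 1 + / eps).
  assert (Hie := Rinv_0_lt_compat _ Heps).
  assert (HR0 : / R0 < eps).
  { rewrite <- (Rinv_inv eps). apply Rinv_lt_contravar; unfold R0; [|lra].
    apply Rmult_lt_0_compat; lra. }
  destruct (node_large R0) as [n0 Hn0].
  set (a := fun n => Cmod (bvec N n) ^ 2).
  set (a0 := fun n => if Nat.leb n0 n then a n else 0).
  assert (Ha : forall n, 0 <= a n) by (intros; apply pow2_ge_0).
  assert (Ha0 : forall n, 0 <= a0 n).
  { intros n. unfold a0. destruct (Nat.leb n0 n); [apply Ha|lra]. }
  (* If these partial sums stayed bounded, a tail of [bvec N], hence [bvec N] itself, would be
     square summable. *)
  destruct (classic (exists k, R0 < sum_n a0 k)) as [[k Hk]|Hno].
  2:{ exfalso. apply Hb.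
      assert (Hex : ex_series a0).
      { apply (sum_n_bounded_ex_series a0 R0); [assumption|]. intros n.
        apply Rnot_lt_le. intros H. apply Hno. now exists n. }
      apply (ex_series_incr_n _ n0). apply (ex_series_incr_n _ n0) in Hex.
      refine (ex_series_ext _ _ _ Hex). intros n. unfold a0.
      destruct (Nat.leb_spec n0 (n0 + n)); [reflexivity|lia]. }
  set (Sg := sum_n a0 k) in *.
  assert (HSg : 0 < Sg) by (unfold R0 in Hk; lra).
  set (g := fun n => if Nat.leb n k then a0 n else 0).
  assert (HgS : sum_n g k = Sg).
  { unfold Sg. apply sum_n_ext_loc. intros n Hn. unfold g.
    destruct (Nat.leb_spec n k); [reflexivity|lia]. }
  assert (Hgsupp : forall n, (S k <= n)%nat -> g n = 0).
  { intros n Hn. unfold g. destruct (Nat.leb_spec n k); [lia|reflexivity]. }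
  assert (Hg : is_series g Sg).
  { rewrite <- HgS. assert (H := is_series_eventually0 (K := R_AbsRing) (V := R_NormedModule)
      g (S k) Hgsupp).
    rewrite sum_Sn, (Hgsupp (S k) (le_n _)) in H.
    replace (sum_n g k) with (plus (sum_n g k) 0); [exact H|]. apply Rplus_0_r. }
  set (f := fun n => if andb (Nat.leb n k) (Nat.leb n0 n)
                     then (Cconj (bvec N n) * RtoC (/ Sg))%C else RtoC 0).
  assert (Hsn : forall n, 0 <= sqrt (mu n)) by (intros; apply sqrt_pos).
  assert (HiS : 0 < / Sg) by now apply Rinv_0_lt_compat.
  assert (Hfin : fin_supp f).
  { exists (S k). intros n Hn. unfold f. destruct (Nat.leb_spec n k); [lia|reflexivity]. }
  exists f. split; [assumption|]. split; [|split].
  - assert (E : nrm2 f = / Sg).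
    { unfold nrm2. rewrite (Series_ext _ (fun n => / Sg * / Sg * g n)).
      - rewrite Series_scal_l, (is_series_unique _ _ Hg). field. lra.
      - intros n. unfold f, g, a0. destruct (Nat.leb n k), (Nat.leb n0 n); simpl andb; cbv iota;
          rewrite ?Cmod_0; try ring.
        rewrite Cmod_mult, Cmod_conj, Cmod_R, Rabs_pos_eq by lra.
        unfold a. ring. }
    rewrite E. apply Rlt_trans with (/ R0); [|assumption].
    apply Rinv_lt_contravar; [|assumption]. apply Rmult_lt_0_compat; [unfold R0|]; lra.
  - assert (E : forall n, (pow_n (t n) N * f n * s n)%C = RtoC (/ Sg * g n)).
    { intros n. unfold f, g, a0.
      destruct (Nat.leb n k), (Nat.leb n0 n); simpl andb; cbv iota;
        rewrite ?Rmult_0_r; try ring.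
      unfold a. rewrite RtoC_mult, Cmod2_conj. unfold bvec. ring. }
    assert (H : is_series (fun n => RtoC (/ Sg * g n)) (RtoC 1)).
    { replace (RtoC 1) with (Csum_n (fun n => RtoC (/ Sg * g n)) (S k)).
      - apply (is_series_eventually0 (K := C_AbsRing) (V := C_NormedModule)).
        intros n Hn. rewrite Hgsupp by lia. now rewrite Rmult_0_r.
      - rewrite Csum_n_RtoC. f_equal.
        rewrite (sum_n_mult_l (K := R_Ring) (/ Sg) g).
        rewrite sum_Sn, Hgsupp by lia.
        change (/ Sg * (@sum_n R_AbelianMonoid g k + 0) = 1). rewrite HgS. field. lra. }
    refine (Cis_series_ext _ _ _ _ H). intros n. now rewrite E.
  - intros i Hi. destruct (moment_fin i f Hfin) as [v Hv]. exists v. split; [assumption|].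
    assert (Hterm : forall n, 0 <= Cmod (pow_n (t n) i * f n * s n)%C
                              <= / R0 * / Sg * g n).
    { intros n. split; [apply Cmod_ge_0|]. unfold f, g, a0.
      destruct (Nat.leb_spec n k), (Nat.leb_spec n0 n); simpl andb; cbv iota;
        rewrite ?Cmod_mult, ?Cmod_0; try lra.
      unfold a. rewrite Cmod_conj, Cmod_bvec. unfold bvec.
      rewrite !Cmod_mult, !Cmod_pow_n, !Cmod_R, !(Rabs_pos_eq (sqrt (mu n))),
        (Rabs_pos_eq (/ Sg)) by (apply sqrt_pos || lra).
      specialize (Hn0 n ltac:(assumption)). set (r := Cmod (t n)) in *.
      assert (Hr0 : 0 < R0) by (unfold R0; lra).
      assert (Hr1 : 1 <= r) by (unfold R0 in Hn0; lra).
      assert (Hmu : sqrt (mu n) * sqrt (mu n) = mu n).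
      { apply sqrt_sqrt. left. destruct Hdata as (_ & _ & Hmu & _). apply Hmu. }
      replace (r ^ i * (r ^ N * sqrt (mu n) * / Sg) * sqrt (mu n))
        with (r ^ i * (/ Sg * r ^ N * (sqrt (mu n) * sqrt (mu n)))) by ring.
      rewrite Hmu. replace (2 * N)%nat with (N + N)%nat by lia. rewrite pow_add.
      replace (/ R0 * / Sg * (r ^ N * r ^ N * mu n))
        with (/ R0 * r ^ N * (/ Sg * r ^ N * mu n)) by ring.
      apply Rmult_le_compat_r.
      - repeat apply Rmult_le_pos; try lra; [apply pow_le; lra|].
        rewrite <- Hmu. now apply Rmult_le_pos.
      - apply Rmult_le_reg_l with R0; [assumption|].
        rewrite <- Rmult_assoc, Rinv_r, Rmult_1_l by lra.
        apply Rle_trans with (r ^ (S i)); [|apply Rle_pow; [assumption|lia]].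
        simpl. apply Rmult_le_compat_r; [apply pow_le|]; lra. }
    assert (Hex : ex_series (fun n => / R0 * / Sg * g n)).
    { apply (ex_series_scal (K := R_AbsRing) (V := R_NormedModule)). now exists Sg. }
    eapply Rle_lt_trans;
      [apply (Cmod_series_le _ _ Hv (ex_series_Rle _ _ Hterm Hex))|].
    eapply Rle_lt_trans; [apply (Series_le _ _ Hterm Hex)|].
    rewrite Series_scal_l, (is_series_unique _ _ Hg), Rmult_assoc, Rinv_l by lra. lra.
Qed.

(** For a divergent moment any bound will do. The normalisation [1 <= K] makes the bound usable as a
    denominator. *)
Lemma moments_bounded (E : nat -> C) (N : nat) : exists K, 1 <= K /\
  forall l v, (l <= N)%nat -> moment l E v -> Cmod v <= K.
Proof.
  assert (Hone : forall l, exists K, forall v, moment l E v -> Cmod v <= K).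
  { intros l. destruct (classic (exists v, moment l E v)) as [[v Hv]|Hn].
    - exists (Cmod v). intros v' Hv'. rewrite (moment_unique l E v' v Hv' Hv). lra.
    - exists 0. intros v Hv. exfalso. apply Hn. now exists v. }
  induction N as [|N (K & HK & H)].
  - destruct (Hone 0%nat) as [K HK]. exists (Rmax 1 K). split; [apply Rmax_l|].
    intros l v Hl Hv. replace l with 0%nat in Hv by lia.
    eapply Rle_trans; [apply (HK v Hv)|apply Rmax_r].
  - destruct (Hone (S N)) as [K' HK']. exists (Rmax K K'). split.
    + eapply Rle_trans; [exact HK|apply Rmax_l].
    + intros l v Hl Hv. destruct (Nat.eq_dec l (S N)) as [->|].
      * eapply Rle_trans; [apply (HK' v Hv)|apply Rmax_r].
      * eapply Rle_trans; [apply (H l v ltac:(lia) Hv)|apply Rmax_l].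
Qed.

(** Each step removes the moment of order [i], already small, by a multiple of the divided
    difference of order [i], whose lower moments vanish. [eps] is quantified inside the induction
    because the constants of that divided difference must be beaten by a smaller tolerance. *)
Lemma almost_dual_vector_corrected (N i : nat) : ~ l2 (bvec N) -> (i <= N)%nat ->
  forall eps, 0 < eps -> exists e, fin_supp e /\ nrm2 e < eps /\
    (forall l, (l < i)%nat -> moment l e (RtoC 0)) /\
    forall l, (l <= N)%nat -> exists v, moment l e v /\
      Cmod (v - (if Nat.eqb l N then RtoC 1 else RtoC 0))%C < eps.
Proof.
  intros Hb. induction i as [|i IH]; intros Hi eps Heps.
  - destruct (almost_dual_vector N eps Hb Heps) as (f & Hf & Hn & H1 & H0).
    exists f. split; [assumption|]. split; [assumption|]. split; [intros; lia|].
    intros l Hl. destruct (Nat.eqb_spec l N) as [->|Hne].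
    + exists (RtoC 1). split; [assumption|].
      replace (1 - 1)%C with (RtoC 0) by ring. now rewrite Cmod_0.
    + destruct (H0 l) as (v & Hv & Hlt); [lia|]. exists v. split; [assumption|].
      now replace (v - 0)%C with v by ring.
  - destruct (divided_difference_fin i) as (E & HE & HE0 & HE1).
    assert (HEl := fin_supp_l2 E HE). assert (HEn := nrm2_nonneg E HEl).
    destruct (moments_bounded E N) as (K0 & HK0 & HKm).
    set (K := Rmax K0 (nrm2 E)).
    assert (HK1 : K0 <= K) by apply Rmax_l. assert (HK2 : nrm2 E <= K) by apply Rmax_r.
    (* The factor [4 * K] absorbs the cost of the correction: at most 2 e0 + 2 K e0 in the squared
       norm and e0 + K e0 in each moment. The cap at 1 gives |vi|^2 <= e0. *)
    set (e0 := Rmin 1 (eps / (4 * K))).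
    assert (He0 : 0 < e0).
    { apply Rmin_glb_lt; [lra|]. apply Rdiv_lt_0_compat; lra. }
    assert (He1 : e0 <= 1) by apply Rmin_l.
    assert (He2 : e0 * (4 * K) <= eps).
    { replace eps with (eps / (4 * K) * (4 * K)) by (field; lra).
      apply Rmult_le_compat_r; [lra|apply Rmin_r]. }
    destruct (IH ltac:(lia) e0 He0) as (e & He & Hen & Hez & Hem).
    assert (Hel := fin_supp_l2 e He).
    destruct (Hem i ltac:(lia)) as (vi & Hvi & Hvi').
    destruct (Nat.eqb_spec i N) as [|_]; [lia|].
    replace (vi - 0)%C with vi in Hvi' by ring.
    assert (Hvi0 := Cmod_ge_0 vi).
    exists (fun n => e n + (- vi) * E n)%C. split; [|split; [|split]].
    + apply fin_supp_plus; [assumption|now apply fin_supp_scal].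
    + eapply Rle_lt_trans; [apply nrm2_plus; [assumption|now apply l2_scal]|].
      rewrite nrm2_scal, Cmod_opp.
      assert (Cmod vi ^ 2 <= e0) by nra.
      assert (Cmod vi ^ 2 * nrm2 E <= e0 * K)
        by (apply Rmult_le_compat; [apply pow2_ge_0|lra|lra|lra]).
      nra.
    + intros l Hl. destruct (Nat.eq_dec l i) as [->|Hne].
      * replace (RtoC 0) with (vi + (- vi) * 1)%C by ring.
        apply moment_plus; [assumption|now apply moment_scal].
      * replace (RtoC 0) with (0 + (- vi) * 0)%C by ring.
        apply moment_plus; [apply Hez; lia|apply moment_scal, HE0; lia].
    + intros l Hl. destruct (Hem l Hl) as (v & Hv & Hlt).
      destruct (moment_fin l E HE) as [u Hu]. exists (v + (- vi) * u)%C. split.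
      * apply moment_plus; [assumption|now apply moment_scal].
      * set (x := if Nat.eqb l N then RtoC 1 else RtoC 0) in *.
        replace (v + - vi * u - x)%C with ((v - x) + (- vi) * u)%C by ring.
        eapply Rle_lt_trans; [apply Cmod_triangle|].
        rewrite Cmod_mult, Cmod_opp.
        assert (Hu' := HKm l u Hl Hu). assert (Hu0 := Cmod_ge_0 u).
        assert (Cmod vi * Cmod u <= e0 * K) by (apply Rmult_le_compat; lra).
        nra.
Qed.

(* The moment functional of order [N] is unbounded modulo the lower ones. *)
Lemma small_divided_difference (N : nat) (eps : R) : ~ l2 (bvec N) -> 0 < eps ->
  exists E, fin_supp E /\ (forall i, (i < N)%nat -> moment i E (RtoC 0)) /\
    moment N E (RtoC 1) /\ nrm2 E < eps.
Proof.
  intros Hb Heps.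
  (* Tolerance 1/2 keeps the moment of order [N] at modulus at least 1/2, so normalising it costs at
     most a factor 4 in [nrm2]. *)
  assert (He0 : 0 < Rmin (/ 2) (eps / 4)) by (apply Rmin_glb_lt; lra).
  destruct (almost_dual_vector_corrected N N Hb (le_n _) _ He0)
    as (e & He & Hen & Hez & Hem).
  destruct (Hem N (le_n _)) as (v & Hv & Hlt). rewrite Nat.eqb_refl in Hlt.
  assert (H1 : Rmin (/ 2) (eps / 4) <= / 2) by apply Rmin_l.
  assert (H2 : Rmin (/ 2) (eps / 4) <= eps / 4) by apply Rmin_r.
  assert (Hv1 := Cmod_sub_ge (RtoC 1) (1 - v)%C). rewrite Cmod_1 in Hv1.
  replace (1 - (1 - v))%C with v in Hv1 by ring. rewrite (Cmod_minus_sym (RtoC 1) v) in Hv1.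
  assert (Hv2 : / 2 <= Cmod v) by lra.
  assert (Hv0 : v <> (RtoC 0)) by (apply Cmod_gt_0; lra).
  assert (Hn0 := nrm2_nonneg e (fin_supp_l2 e He)).
  exists (fun n => / v * e n)%C. split; [|split; [|split]].
  - now apply fin_supp_scal.
  - intros i Hi. replace (RtoC 0) with (/ v * 0)%C by ring.
    now apply moment_scal, Hez.
  - replace (RtoC 1) with (/ v * v)%C by (field; assumption). now apply moment_scal.
  - rewrite nrm2_scal, Cmod_inv by assumption.
    assert (/ Cmod v <= 2).
    { rewrite <- (Rinv_inv 2). apply Rinv_le_contravar; lra. }
    assert (0 < / Cmod v) by (apply Rinv_0_lt_compat; lra).
    assert ((/ Cmod v) ^ 2 <= 4) by nra.
    apply Rle_lt_trans with (4 * nrm2 e); [|lra].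
    apply Rmult_le_compat_r; lra.
Qed.

Lemma truncation_approx (x : nat -> C) (eps : R) : l2 x -> 0 < eps ->
  exists y, fin_supp y /\ nrm2 (fun n => x n - y n)%C < eps.
Proof.
  intros Hx Heps.
  set (a := fun n => Cmod (x n) ^ 2).
  assert (Hlim := Series_correct a Hx).
  destruct (proj1 (filterlim_locally_ball_norm (K := R_AbsRing) (U := R_NormedModule)
     (F := eventually) (sum_n a) (Series a)) Hlim (mkposreal _ Heps)) as [k Hk].
  specialize (Hk k (le_n _)).
  exists (fun n => if Nat.leb n k then x n else RtoC 0). split.
  - exists (S k). intros n Hn. destruct (Nat.leb_spec n k); [lia|reflexivity].
  - set (g := fun n => if Nat.leb n k then a n else 0).
    assert (Hg : is_series g (sum_n a k)).
    { replace (sum_n a k) with (sum_n g (S k)).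
      - apply (is_series_eventually0 (K := R_AbsRing) (V := R_NormedModule)).
        intros n Hn. unfold g. destruct (Nat.leb_spec n k); [lia|reflexivity].
      - rewrite sum_Sn. unfold g at 2. destruct (Nat.leb_spec (S k) k); [lia|].
        rewrite (sum_n_ext_loc g a).
        + apply Rplus_0_r.
        + intros n Hn. unfold g. destruct (Nat.leb_spec n k); [reflexivity|lia]. }
    unfold nrm2. rewrite (Series_ext _ (fun n => a n - g n)).
    + rewrite Series_minus, (is_series_unique _ _ Hg); [|assumption|now exists (sum_n a k)].
      change (Rabs (sum_n a k - Series a) < eps) in Hk.
      apply Rabs_def2 in Hk. lra.
    + intros n. unfold g, a. destruct (Nat.leb n k).
      * replace (x n - x n)%C with (RtoC 0) by ring. rewrite Cmod_0. ring.
      * replace (x n - 0)%C with (x n) by ring. ring.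
Qed.

Lemma moment_continuous (j : nat) (eps : R) : l2 (bvec j) -> 0 < eps ->
  exists delta, 0 < delta /\ forall c v, l2 c -> nrm2 c < delta -> moment j c v -> Cmod v < eps.
Proof.
  intros Hb Heps. destruct (l2_pairing_small (bvec j) eps Hb Heps) as (d & Hd & H).
  exists d. split; [assumption|]. intros c v Hc Hsm Hv. apply (H c v Hc Hsm).
  refine (Cis_series_ext _ _ _ _ Hv). intros n. unfold bvec. simpl. ring.
Qed.

(** Orders are treated increasingly: subtracting v E, where E has vanishing lower moments and moment
    1 at the current order, kills the moment v of the approximant. Either this moment is continuous,
    and v is small against a fixed E, or E can be taken small after v is known. *)
Lemma moment_free_approx (N : nat) (x : nat -> C) : l2 x ->
  (forall j, (j < N)%nat -> ~ l2 (bvec j) \/ moment j x (RtoC 0)) ->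
  forall eps, 0 < eps -> exists y, fin_supp y /\
    (forall j, (j < N)%nat -> moment j y (RtoC 0)) /\ nrm2 (fun n => x n - y n)%C < eps.
Proof.
  intros Hx. induction N as [|N IH]; intros Hmom eps Heps.
  - destruct (truncation_approx x eps Hx Heps) as (y & Hy & Hlt).
    exists y. split; [assumption|]. split; [intros; lia|assumption].
  - assert (IH' := IH (fun j Hj => Hmom j (Nat.lt_lt_succ_r _ _ Hj))).
    (* Two quarters of [eps], one for x - y and one for v E, because [nrm2_plus] doubles both. *)
    assert (Key : forall y v E, fin_supp y -> fin_supp E ->
       (forall j, (j < N)%nat -> moment j y (RtoC 0)) -> moment N y v ->
       (forall j, (j < N)%nat -> moment j E (RtoC 0)) -> moment N E (RtoC 1) ->
       nrm2 (fun n => x n - y n)%C < eps / 4 -> Cmod v ^ 2 * nrm2 E <= eps / 4 ->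
       exists y, fin_supp y /\ (forall j, (j < S N)%nat -> moment j y (RtoC 0)) /\
         nrm2 (fun n => x n - y n)%C < eps).
    { intros y v E Hy HE Hy0 Hyv HE0 HE1 Hxy HvE.
      exists (fun n => y n + (- v) * E n)%C. split; [|split].
      - apply fin_supp_plus; [assumption|now apply fin_supp_scal].
      - intros j Hj. destruct (Nat.eq_dec j N) as [->|Hne].
        + replace (RtoC 0) with (v + (- v) * 1)%C by ring.
          apply moment_plus; [assumption|now apply moment_scal].
        + replace (RtoC 0) with (0 + (- v) * 0)%C by ring.
          apply moment_plus; [apply Hy0; lia|apply moment_scal, HE0; lia].
      - replace (nrm2 (fun n => x n - (y n + - v * E n))%C)
          with (nrm2 (fun n => (x n - y n) + v * E n)%C).
        + eapply Rle_lt_trans; [apply nrm2_plus|].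
          * apply l2_minus; [assumption|now apply fin_supp_l2].
          * now apply l2_scal, fin_supp_l2.
          * rewrite nrm2_scal. lra.
        + unfold nrm2. apply Series_ext. intros n. do 2 f_equal. ring. }
    destruct (classic (l2 (bvec N))) as [Hb|Hb].
    + destruct (Hmom N (Nat.lt_succ_diag_r N)) as [Hn|Hx0]; [contradiction|].
      destruct (divided_difference_fin N) as (E & HE & HE0 & HE1).
      assert (HEn := nrm2_nonneg E (fin_supp_l2 E HE)).
      (* The cap at 1 turns |v| < e1 into |v|^2 <= e1; the other bound pays for the norm of the
         fixed [E]. *)
      set (e1 := Rmin 1 (eps / 4 / (1 + nrm2 E))).
      assert (He1 : 0 < e1).
      { apply Rmin_glb_lt; [lra|]. apply Rdiv_lt_0_compat; lra. }
      destruct (moment_continuous N e1 Hb He1) as (d & Hd & Hcont).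
      destruct (IH' (Rmin (eps / 4) d)) as (y & Hy & Hy0 & Hxy);
        [apply Rmin_glb_lt; lra|].
      destruct (moment_fin N y Hy) as [v Hv].
      apply (Key y v E); try assumption.
      * exact (Rlt_le_trans _ _ _ Hxy (Rmin_l _ _)).
      * assert (Hv1 : Cmod (0 - v)%C < e1).
        { apply (Hcont (fun n => x n - y n)%C).
          - apply l2_minus; [assumption|now apply fin_supp_l2].
          - exact (Rlt_le_trans _ _ _ Hxy (Rmin_r _ _)).
          - now apply moment_minus. }
        replace (0 - v)%C with (- v)%C in Hv1 by ring. rewrite Cmod_opp in Hv1.
        assert (Hv0 := Cmod_ge_0 v).
        assert (e1 <= 1) by apply Rmin_l.
        assert (e1 <= eps / 4 / (1 + nrm2 E)) by apply Rmin_r.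
        assert (Cmod v ^ 2 <= e1) by nra.
        apply Rle_trans with (eps / 4 / (1 + nrm2 E) * (1 + nrm2 E)).
        -- apply Rmult_le_compat; [apply pow2_ge_0|lra|lra|lra].
        -- right. field. lra.
    + destruct (IH' (eps / 4)) as (y & Hy & Hy0 & Hxy); [lra|].
      destruct (moment_fin N y Hy) as [v Hv].
      assert (Hv0 := pow2_ge_0 (Cmod v)).
      destruct (small_divided_difference N (eps / 4 / (1 + Cmod v ^ 2)) Hb)
        as (E & HE & HE0 & HE1 & HEn); [apply Rdiv_lt_0_compat; lra|].
      apply (Key y v E); try assumption.
      apply Rle_trans with ((1 + Cmod v ^ 2) * (eps / 4 / (1 + Cmod v ^ 2))).
      * apply Rmult_le_compat; [lra|apply nrm2_nonneg; now apply fin_supp_l2|lra|lra].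
      * right. field. lra.
Qed.

(** * Subspaces of finite codimension *)

Lemma continuous_Cmult (f g : C -> C) (z : C) :
  continuous f z -> continuous g z -> continuous (fun y => f y * g y)%C z.
Proof.
  rewrite !continuous_C_eps. intros Hf Hg eps Heps.
  assert (Hf0 := Cmod_ge_0 (f z)). assert (Hg0 := Cmod_ge_0 (g z)).
  set (M := Cmod (f z) + Cmod (g z) + 1).
  assert (HM : 0 < M) by (unfold M; lra).
  set (e := Rmin 1 (eps / M / 2)).
  assert (He : 0 < e).
  { apply Rmin_glb_lt; [lra|]. repeat apply Rdiv_lt_0_compat; lra. }
  destruct (Hf e He) as (d1 & Hd1 & H1). destruct (Hg e He) as (d2 & Hd2 & H2).
  exists (Rmin d1 d2). split; [now apply Rmin_glb_lt|]. intros y Hy.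
  specialize (H1 y (Rlt_le_trans _ _ _ Hy (Rmin_l _ _))).
  specialize (H2 y (Rlt_le_trans _ _ _ Hy (Rmin_r _ _))).
  replace (f y * g y - f z * g z)%C
    with ((f y - f z) * (g y - g z) + ((f y - f z) * g z + f z * (g y - g z)))%C by ring.
  eapply Rle_lt_trans; [apply Cmod_triangle|].
  eapply Rle_lt_trans; [apply Rplus_le_compat_l, Cmod_triangle|].
  rewrite !Cmod_mult.
  assert (X1 := Cmod_ge_0 (f y - f z)%C). assert (X2 := Cmod_ge_0 (g y - g z)%C).
  assert (He1 : e <= 1) by apply Rmin_l.
  assert (He2 : e * M <= eps / 2).
  { replace (eps / 2) with (eps / M / 2 * M) by (field; lra).
    apply Rmult_le_compat_r; [lra|apply Rmin_r]. }
  apply Rle_lt_trans with (e * M); [unfold M; nra|lra].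
Qed.

Lemma continuous_Cminus_const (w z : C) : continuous (fun y => y - w)%C z.
Proof.
  apply continuous_C_eps. intros eps Heps. exists eps. split; [assumption|].
  intros y Hy. now replace (y - w - (z - w))%C with (y - z)%C by ring.
Qed.

Lemma continuous_pow_n (k : nat) (z : C) : continuous (fun y : C => pow_n y k) z.
Proof.
  induction k as [|k IH].
  - apply continuous_const.
  - apply (continuous_Cmult (fun y => y) (fun y => pow_n y k)); [|assumption].
    apply continuous_id.
Qed.

(** A quotient supplied by [nearly_invariant] is not determined at [w] by its equation; continuity
    identifies it with the expected function. *)
Lemma cancel_linear_factor (w : C) (g h : C -> C) :
  (forall z, continuous g z) -> (forall z, continuous h z) ->
  (forall z, (z - w) * g z = (z - w) * h z)%C -> g = h.
Proof.
  intros Hg Hh E. apply functional_extensionality.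
  assert (Hne : forall z, z <> w -> g z = h z).
  { intros z Hz. assert (H0 := Csub_neq0 _ _ Hz).
    replace (g z) with (/ (z - w) * ((z - w) * g z))%C by (field; assumption).
    rewrite E. field. assumption. }
  intros z. destruct (classic (z = w)) as [->|Hz]; [|now apply Hne].
  apply Cmod_lt_eps_eq. intros eps Heps.
  assert (He : 0 < eps / 2) by lra.
  destruct (proj1 (continuous_C_eps g w) (Hg w) _ He) as (d1 & Hd1 & H1).
  destruct (proj1 (continuous_C_eps h w) (Hh w) _ He) as (d2 & Hd2 & H2).
  destruct (exists_near w (Rmin d1 d2)) as (y & Hy & Hyd); [now apply Rmin_glb_lt|].
  specialize (H1 y (Rlt_le_trans _ _ _ Hyd (Rmin_l _ _))).
  specialize (H2 y (Rlt_le_trans _ _ _ Hyd (Rmin_r _ _))).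
  rewrite (Hne y Hy) in H1.
  replace (g w - h w)%C with ((h y - h w) - (h y - g w))%C by ring.
  eapply Rle_lt_trans; [apply Cmod_triangle_minus|]. lra.
Qed.

(** * Powers of z and vanishing moments *)

Lemma InH_continuous (F : C -> C) : InH t mu A F -> forall z, continuous F z.
Proof. intros (c & _ & HF & _). exact HF. Qed.

(** [DzN] records only the two extreme powers. Descending from z^N F, each positive power vanishes
    at 0 and can be divided by z within the space. *)
Lemma DzN_powers (N : nat) (F : C -> C) : DzN t mu A N F ->
  forall k, (k <= N)%nat -> InH t mu A (fun z : C => pow_n z k * F z)%C.
Proof.
  intros [HF HN] k Hk.
  remember (N - k)%nat as m eqn:Em. revert k Hk Em. induction m as [|m IH]; intros k Hk Em.
  - now replace k with N by lia.
  - assert (H := IH (S k) ltac:(lia) ltac:(lia)).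
    destruct (InH_nearly_invariant _ (RtoC 0) H) as (g & Hg & E).
    { rewrite Cpow_nS. ring. }
    assert (Eg : g = (fun z : C => pow_n z k * F z)%C); [|rewrite Eg in Hg; exact Hg].
    apply (cancel_linear_factor (RtoC 0)).
    + now apply InH_continuous.
    + intros z. apply (continuous_Cmult (fun y => pow_n y k)); [apply continuous_pow_n|].
      now apply InH_continuous.
    + intros z. rewrite <- E, Cpow_nS. ring.
Qed.

(** Going from z^(k+1) F to z^k F is a division by z; the moment of order 0 of t^k c that it forces
    to vanish is the moment of order k of [c]. *)
Lemma DzN_moments (N : nat) (F : C -> C) (c : nat -> C) : DzN t mu A N F ->
  l2 c -> rep t mu A c F -> forall j, (j < N)%nat -> moment j c (RtoC 0).
Proof.
  intros HF Hc Hrep.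
  assert (Hpow := DzN_powers N F HF).
  assert (Hk : forall k, (k <= N)%nat -> l2 (fun n => pow_n (t n) k * c n)%C /\
     rep t mu A (fun n => pow_n (t n) k * c n)%C (fun z : C => pow_n z k * F z)%C /\
     forall j, (j < k)%nat -> moment j c (RtoC 0)).
  { induction k as [|k IH]; intros Hk.
    - assert (E : (fun n => pow_n (t n) 0 * c n)%C = c).
      { apply functional_extensionality. intros n. apply Cmult_1_l. }
      assert (E' : (fun z : C => pow_n z 0 * F z)%C = F).
      { apply functional_extensionality. intros z. apply Cmult_1_l. }
      rewrite E, E'. repeat split; try assumption; try apply Hrep. intros; lia.
    - destruct (IH ltac:(lia)) as (Hl & Hr & Hm).
      destruct (Hpow (S k) Hk) as (c' & Hc' & Hr').
      destruct (division_coefs (RtoC 0) _ _ _ _ Hc' Hl Hr' Hr) as [Ec H0].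
      { intros z. rewrite Cpow_nS. ring. }
      assert (E : c' = (fun n => pow_n (t n) (S k) * c n)%C).
      { apply functional_extensionality. intros n. rewrite Ec, Cpow_nS. ring. }
      subst c'. split; [assumption|]. split; [assumption|].
      intros j Hj. destruct (Nat.eq_dec j k) as [->|Hne]; [exact H0|apply Hm; lia]. }
  intros j Hj. exact (proj2 (proj2 (Hk N (le_n _))) j Hj).
Qed.

(** With finite support every t^k c is square summable, so the vanishing moments alone let
    multiplication by z be iterated through [division_rep]. *)
Lemma DzN_intro (N : nat) (F : C -> C) (c : nat -> C) : fin_supp c -> rep t mu A c F ->
  (forall j, (j < N)%nat -> moment j c (RtoC 0)) -> DzN t mu A N F.
Proof.
  intros Hc HF Hm.
  assert (Hl : forall k, l2 (fun n => pow_n (t n) k * c n)%C).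
  { intros k. apply fin_supp_l2. destruct Hc as [m Hc]. exists m. intros n Hn.
    rewrite (Hc n Hn). ring. }
  split; [exists c; split; [now apply fin_supp_l2|assumption]|].
  exists (fun n => pow_n (t n) N * c n)%C. split; [apply Hl|].
  assert (Hk : forall k, (k <= N)%nat ->
     rep t mu A (fun n => pow_n (t n) k * c n)%C (fun z : C => pow_n z k * F z)%C).
  { induction k as [|k IH]; intros Hk.
    - assert (E : (fun n => pow_n (t n) 0 * c n)%C = c).
      { apply functional_extensionality. intros n. apply Cmult_1_l. }
      assert (E' : (fun z : C => pow_n z 0 * F z)%C = F).
      { apply functional_extensionality. intros z. apply Cmult_1_l. }
      now rewrite E, E'.
    - destruct (rep_ex _ (Hl (S k))) as [G HG].
      replace (fun z : C => pow_n z (S k) * F z)%C with G; [assumption|].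
      apply functional_extensionality. intros z.
      rewrite (division_rep (RtoC 0) _ _ _ _ (Hl (S k)) (Hl k) HG (IH ltac:(lia))).
      + rewrite Cpow_nS. ring.
      + intros n. rewrite Cpow_nS. ring.
      + apply Hm. lia. }
  now apply Hk.
Qed.

(** * Finite sums and linear dependence modulo a subspace *)

Lemma Csum_n_mult_l (a : C) (u : nat -> C) (n : nat) :
  Csum_n (fun k => a * u k)%C n = (a * Csum_n u n)%C.
Proof. apply (sum_n_mult_l (K := C_Ring)). Qed.

Lemma Csum_n_mult_r (a : C) (u : nat -> C) (n : nat) :
  Csum_n (fun k => u k * a)%C n = (Csum_n u n * a)%C.
Proof. apply (sum_n_mult_r (K := C_Ring)). Qed.

Lemma Csum_n_plus (u v : nat -> C) (n : nat) :
  Csum_n (fun k => u k + v k)%C n = (Csum_n u n + Csum_n v n)%C.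
Proof. apply (sum_n_plus (G := C_AbelianMonoid)). Qed.

Lemma Csum_n_ext (u v : nat -> C) (n : nat) :
  (forall k, (k <= n)%nat -> u k = v k) -> Csum_n u n = Csum_n v n.
Proof. apply (sum_n_ext_loc (G := C_AbelianMonoid)). Qed.

Lemma Csum_n_S (u : nat -> C) (n : nat) : Csum_n u (S n) = (Csum_n u n + u (S n))%C.
Proof. apply (sum_Sn (G := C_AbelianMonoid)). Qed.

(* [ring] does not recognise equations between sums, whose type is [AbelianMonoid.sort _]. *)
Ltac Cring := match goal with |- ?x = ?y => change (@eq C x y) end; ring.

Lemma Csum_n_zero (u : nat -> C) (n : nat) :
  (forall k, (k <= n)%nat -> u k = (RtoC 0)) -> Csum_n u n = (RtoC 0).
Proof.
  induction n as [|n IH]; intros H.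
  - rewrite sum_O. apply H. lia.
  - rewrite Csum_n_S, IH, (H (S n)) by (intros; (apply H; lia) || lia). Cring.
Qed.

Lemma Csum_n_delta (a : nat -> C) (j n : nat) : (j <= n)%nat ->
  Csum_n (fun i => a i * (if Nat.eqb j i then RtoC 1 else RtoC 0))%C n = a j.
Proof.
  intros Hj. induction Hj as [|n Hj IH].
  - destruct j as [|j].
    + rewrite sum_O. simpl. apply Cmult_1_r.
    + rewrite Csum_n_S, Nat.eqb_refl, Csum_n_zero; [Cring|].
      intros k Hk. destruct (Nat.eqb_spec (S j) k); [lia|Cring].
  - rewrite Csum_n_S, IH. destruct (Nat.eqb_spec j (S n)); [lia|Cring].
Qed.

Lemma subspace_sum (P : (C -> C) -> Prop) (a : nat -> C) (h : nat -> C -> C) (n : nat) :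
  subspaceH t mu A P -> (forall i, (i <= n)%nat -> P (h i)) ->
  P (fun z => Csum_n (fun i => a i * h i z)%C n).
Proof.
  intros (_ & _ & Hadd & Hscal) H. induction n as [|n IH].
  - replace (fun z => Csum_n (fun i => a i * h i z)%C 0) with (fun z => a 0%nat * h 0%nat z)%C.
    + apply Hscal, H. lia.
    + apply functional_extensionality. intros z. now rewrite sum_O.
  - replace (fun z => Csum_n (fun i => a i * h i z)%C (S n))
      with (fun z => Csum_n (fun i => a i * h i z)%C n + a (S n) * h (S n) z)%C.
    + apply (Hadd (fun z => Csum_n (fun i => a i * h i z)%C n)).
      * apply IH. intros i Hi. apply H. lia.
      * apply Hscal, H. lia.
    + apply functional_extensionality. intros z. now rewrite Csum_n_S.
Qed.

(** [b] lies in the left kernel of the coordinate matrix [M], so the [G] components cancel once the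
    two sums are exchanged. *)
Lemma combination_mod_subspace (P : (C -> C) -> Prop) (X h G : nat -> C -> C)
  (M : nat -> nat -> C) (b : nat -> C) (m k : nat) : subspaceH t mu A P ->
  (forall i, (i <= m)%nat -> P (h i)) ->
  (forall i, (i <= m)%nat -> forall z,
     X i z = (h i z + Csum_n (fun l => M i l * G l z) k)%C) ->
  (forall l, (l <= k)%nat -> Csum_n (fun i => b i * M i l)%C m = (RtoC 0)) ->
  P (fun z => Csum_n (fun i => b i * X i z)%C m).
Proof.
  intros HP Hh HX Hb.
  replace (fun z => Csum_n (fun i => b i * X i z)%C m)
    with (fun z => Csum_n (fun i => b i * h i z)%C m); [now apply subspace_sum|].
  apply functional_extensionality. intros z.
  rewrite (Csum_n_ext (fun i => b i * X i z)%C
    (fun i => b i * h i z + Csum_n (fun l => b i * M i l * G l z) k)%C).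
  - rewrite Csum_n_plus, (sum_n_switch (G := C_AbelianMonoid)), (Csum_n_zero _ k);
      [symmetry; apply Cplus_0_r|].
    intros l Hl. rewrite Csum_n_mult_r, Hb by assumption. Cring.
  - intros i Hi. rewrite HX, Cmult_plus_distr_l, <- Csum_n_mult_l by assumption.
    f_equal. apply Csum_n_ext. intros l _. Cring.
Qed.

Lemma functional_choice_nat {B : Type} (R : nat -> B -> Prop) :
  (forall n, exists y, R n y) -> exists f, forall n, R n (f n).
Proof.
  intros H.
  exists (fun n => proj1_sig (constructive_indefinite_description _ (H n))).
  intros n. exact (proj2_sig (constructive_indefinite_description _ (H n))).
Qed.

(* [N + 1] functions [F, z F, ..., z^N F] are dependent modulo a subspace of codimension [N],
   so that [p F] belongs to it for some polynomial [p]; near invariance then allows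
   to divide by the linear factors of [p]. *)
Lemma nearly_invariant_contains_DzN (P : (C -> C) -> Prop) (N : nat) (F : C -> C) :
  (1 <= N)%nat -> nearly_invariant P -> codimH t mu A P N -> DzN t mu A N F -> P F.
Proof.
  intros HN Hinv (HP & G & HG & Hspan & _) HF.
  assert (Hpow := DzN_powers N F HF).
  destruct (functional_choice_nat (fun i (aM : (nat -> C) * (C -> C)) =>
      (i <= N)%nat -> P (snd aM) /\ forall z, (pow_n z i * F z =
        snd aM z + Csum_n (fun l => fst aM l * G l z) (N - 1))%C)) as [aM HaM].
  { intros i. destruct (classic (i <= N)%nat) as [Hi|Hi].
    - destruct (Hspan _ (Hpow i Hi)) as (a & h & Hh & E). exists (a, h). now split.
    - exists (fun _ => RtoC 0, fun _ => RtoC 0). contradiction. }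
  (* The N + 1 coordinate rows have length N; padding by a zero column of index [N] gives the square
     matrix that [singular_kernel] expects. *)
  set (M := fun i l => if Nat.ltb l N then fst (aM i) l else RtoC 0).
  destruct (ComplexAlgebra.singular_kernel (S N) N M) as (b & Hb & HbM).
  { lia. }
  { intros i _. unfold M. now rewrite Nat.ltb_irrefl. }
  assert (HS : P (fun z => Csum_n (fun i => b i * (pow_n z i * F z))%C N)).
  { apply (combination_mod_subspace P (fun i (z : C) => pow_n z i * F z)%C (fun i => snd (aM i)) G
             (fun i => fst (aM i)) b N (N - 1) HP).
    - intros i Hi. now apply HaM.
    - intros i Hi z. now apply HaM.
    - intros l Hl. specialize (HbM l ltac:(lia)).
      replace (S N - 1)%nat with N in HbM by lia.
      rewrite <- HbM. apply Csum_n_ext. intros i _. unfold M.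
      destruct (Nat.ltb_spec l N); [reflexivity|lia]. }
  destruct (ComplexAlgebra.poly_factor N b) as (k & rs & Hk & Hfac).
  { destruct Hb as (i & Hi & Hbi). exists i. split; [lia|assumption]. }
  assert (Hcont := InH_continuous F (proj1 HF)).
  set (prodf := fun rs z => fold_right (fun r y => Cmult (Cminus z r) y) (RtoC 1) rs).
  assert (HprodF : P (fun z => prodf rs z * F z)%C).
  { destruct HP as (_ & _ & _ & Hscal).
    replace (fun z => prodf rs z * F z)%C
      with (fun z => / k * Csum_n (fun i => b i * (pow_n z i * F z)) N)%C; [now apply Hscal|].
    apply functional_extensionality. intros z.
    rewrite (Csum_n_ext (fun i => b i * (pow_n z i * F z))%C
       (fun i => (b i * pow_n z i) * F z)%C) by (intros; Cring).
    rewrite Csum_n_mult_r. rewrite Hfac. fold (prodf rs z). field. assumption. }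
  clear Hfac. revert HprodF. induction rs as [|r rs IH]; intros HprodF.
  - replace F with (fun z => prodf nil z * F z)%C; [assumption|].
    apply functional_extensionality. intros z. apply Cmult_1_l.
  - apply IH. destruct (Hinv _ r HprodF) as (g & Hg & E).
    { unfold prodf. simpl. Cring. }
    replace (fun z => prodf rs z * F z)%C with g; [assumption|].
    apply (cancel_linear_factor r).
    + apply InH_continuous. now apply HP.
    + intros z. apply continuous_Cmult; [|apply Hcont].
      clear. induction rs as [|r rs IH]; [apply continuous_const|].
      apply (continuous_Cmult (fun y => y - r)%C (prodf rs)); [|assumption].
      apply continuous_Cminus_const.
    + intros z. rewrite <- E. unfold prodf. simpl. Cring.
Qed.

(** If coefficient [p] could always be avoided, the N independent vectors of the complement would be
    combinations of N - 1 functions modulo [P]: their coordinate matrix has a zero column, and its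
    left kernel is a forbidden relation. *)
Lemma codim_not_spanned (P : (C -> C) -> Prop) (N p : nat) (E : nat -> C -> C) :
  codimH t mu A P N -> (p < N)%nat ->
  ~ (forall F, InH t mu A F -> exists a h, P h /\ a p = (RtoC 0) /\
       forall z, F z = (h z + Csum_n (fun i => a i * E i z) (N - 1))%C).
Proof.
  intros (HP & G & HG & _ & Hind) Hp Hspan.
  destruct (functional_choice_nat (fun i (aM : (nat -> C) * (C -> C)) =>
      (i < N)%nat -> P (snd aM) /\ fst aM p = RtoC 0 /\ forall z,
        (G i z = snd aM z + Csum_n (fun l => fst aM l * E l z) (N - 1))%C)) as [aM HaM].
  { intros i. destruct (classic (i < N)%nat) as [Hi|Hi].
    - destruct (Hspan _ (HG i Hi)) as (a & h & H). exists (a, h). intros _. exact H.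
    - exists (fun _ => RtoC 0, fun _ => RtoC 0). contradiction. }
  destruct (ComplexAlgebra.singular_kernel N p (fun i => fst (aM i)) Hp)
    as (b & (i & Hi & Hbi) & HbM); [intros i Hi; now apply HaM|].
  apply Hbi, Hind; [|assumption].
  apply (combination_mod_subspace P G (fun i => snd (aM i)) E (fun i => fst (aM i)) b
           (N - 1) (N - 1) HP).
  - intros k Hk. apply HaM. lia.
  - intros k Hk. apply HaM. lia.
  - intros l Hl. apply HbM. lia.
Qed.

(** Biorthogonality to the moments is extended one order at a time: the divided difference of order
    [N] corrects the new moment and leaves the lower ones alone. *)
Lemma dual_vector (N j : nat) : (j < N)%nat -> exists e, fin_supp e /\
  forall i, (i < N)%nat -> moment i e (if Nat.eqb i j then RtoC 1 else RtoC 0).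
Proof.
  induction N as [|N IH]; intros Hj; [lia|].
  destruct (divided_difference_fin N) as (E & HE & HE0 & HE1).
  destruct (Nat.eq_dec j N) as [->|Hne].
  - exists E. split; [assumption|]. intros i Hi.
    destruct (Nat.eqb_spec i N) as [->|]; [assumption|apply HE0; lia].
  - destruct (IH ltac:(lia)) as (e & He & Hm).
    destruct (moment_fin N e He) as [v Hv].
    exists (fun n => e n + (- v) * E n)%C. split.
    + apply fin_supp_plus; [assumption|now apply fin_supp_scal].
    + intros i Hi. destruct (Nat.eq_dec i N) as [->|HiN].
      * destruct (Nat.eqb_spec N j) as [|_]; [lia|].
        replace (RtoC 0) with (v + (- v) * 1)%C by Cring.
        apply moment_plus; [assumption|now apply moment_scal].
      * set (x := if Nat.eqb i j then RtoC 1 else RtoC 0).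
        replace x with (x + (- v) * 0)%C by Cring.
        apply moment_plus; [apply Hm; lia|apply moment_scal, HE0; lia].
Qed.

Lemma dual_family (N : nat) : exists (e : nat -> nat -> C) (E : nat -> C -> C),
  forall j, (j < N)%nat -> l2 (e j) /\ rep t mu A (e j) (E j) /\
    forall i, (i < N)%nat -> moment i (e j) (if Nat.eqb i j then RtoC 1 else RtoC 0).
Proof.
  destruct (functional_choice_nat (fun j (eE : (nat -> C) * (C -> C)) =>
     (j < N)%nat -> l2 (fst eE) /\ rep t mu A (fst eE) (snd eE) /\
     forall i, (i < N)%nat -> moment i (fst eE) (if Nat.eqb i j then RtoC 1 else RtoC 0)))
    as [eE HeE].
  { intros j. destruct (classic (j < N)%nat) as [Hj|Hj].
    - destruct (dual_vector N j Hj) as (e & He & Hm).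
      assert (Hl := fin_supp_l2 e He). destruct (rep_ex e Hl) as [E HE].
      exists (e, E). now split.
    - exists (fun _ => RtoC 0, fun _ => RtoC 0). contradiction. }
  exists (fun j => fst (eE j)), (fun j => snd (eE j)). exact HeE.
Qed.

Lemma combination_rep (a : nat -> C) (e : nat -> nat -> C) (E : nat -> C -> C) (n : nat) :
  (forall i, (i <= n)%nat -> l2 (e i) /\ rep t mu A (e i) (E i)) ->
  l2 (fun k => Csum_n (fun i => a i * e i k)%C n) /\
  rep t mu A (fun k => Csum_n (fun i => a i * e i k)%C n)
    (fun z => Csum_n (fun i => a i * E i z)%C n).
Proof.
  induction n as [|n IH]; intros H.
  - destruct (H 0%nat (le_n _)) as [H1 H2].
    assert (E1 : (fun k => Csum_n (fun i => a i * e i k)%C 0) = (fun k => a 0%nat * e 0%nat k)%C)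
      by (apply functional_extensionality; intros; now rewrite sum_O).
    assert (E2 : (fun k => Csum_n (fun i => a i * E i k)%C 0) = (fun k => a 0%nat * E 0%nat k)%C)
      by (apply functional_extensionality; intros; now rewrite sum_O).
    rewrite E1, E2. split; [now apply l2_scal|now apply rep_scal].
  - destruct (H (S n) (le_n _)) as [H1 H2].
    destruct IH as [IH1 IH2]; [intros i Hi; apply H; lia|].
    assert (E1 : (fun k => Csum_n (fun i => a i * e i k)%C (S n)) =
       (fun k => Csum_n (fun i => a i * e i k) n + a (S n) * e (S n) k)%C)
      by (apply functional_extensionality; intros; now rewrite Csum_n_S).
    assert (E2 : (fun k => Csum_n (fun i => a i * E i k)%C (S n)) =
       (fun k => Csum_n (fun i => a i * E i k) n + a (S n) * E (S n) k)%C)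
      by (apply functional_extensionality; intros; now rewrite Csum_n_S).
    rewrite E1, E2. split.
    + apply l2_plus; [assumption|now apply l2_scal].
    + apply rep_plus; [assumption|now apply rep_scal].
Qed.

Lemma combination_moment (j : nat) (a v : nat -> C) (e : nat -> nat -> C) (n : nat) :
  (forall i, (i <= n)%nat -> moment j (e i) (v i)) ->
  moment j (fun k => Csum_n (fun i => a i * e i k)%C n) (Csum_n (fun i => a i * v i)%C n).
Proof.
  induction n as [|n IH]; intros H.
  - rewrite sum_O.
    replace (fun k => Csum_n (fun i => a i * e i k)%C 0) with (fun k => a 0%nat * e 0%nat k)%C.
    + now apply moment_scal, H.
    + apply functional_extensionality. intros k. now rewrite sum_O.
  - rewrite Csum_n_S.
    replace (fun k => Csum_n (fun i => a i * e i k)%C (S n))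
      with (fun k => Csum_n (fun i => a i * e i k) n + a (S n) * e (S n) k)%C.
    + apply moment_plus; [apply IH; intros i Hi; apply H; lia|now apply moment_scal, H].
    + apply functional_extensionality. intros k. now rewrite Csum_n_S.
Qed.

(** The approximants of [moment_free_approx] are finitely supported, hence belong to [DzN]; so only
    continuous moments constrain the closure. *)
Lemma closure_DzN_intro (N : nat) (x : nat -> C) (F : C -> C) : l2 x -> rep t mu A x F ->
  (forall j, (j < N)%nat -> ~ l2 (bvec j) \/ moment j x (RtoC 0)) ->
  closureH t mu A (DzN t mu A N) F.
Proof.
  intros Hx HF Hmom. split; [now exists x|].
  destruct (functional_choice_nat (fun k (yG : (nat -> C) * (C -> C)) =>
     l2 (fst yG) /\ rep t mu A (fst yG) (snd yG) /\ DzN t mu A N (snd yG) /\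
     nrm2 (fun n => x n - fst yG n)%C < / (INR k + 1))) as [yG HyG].
  { intros k.
    destruct (moment_free_approx N x Hx Hmom (/ (INR k + 1))) as (y & Hy & Hy0 & Hlt).
    { apply Rinv_0_lt_compat. assert (H := pos_INR k). lra. }
    assert (Hl := fin_supp_l2 y Hy). destruct (rep_ex y Hl) as [G HG].
    exists (y, G). repeat split; try assumption; try apply HG; now apply (DzN_intro N G y). }
  exists (fun k => snd (yG k)). split; [intros k; apply HyG|].
  exists (fun k => fst (yG k)), x. split; [|split; [assumption|split; [assumption|]]].
  - intros k. split; apply HyG.
  - apply (is_lim_seq_le_le (fun _ => 0) _ (fun k => / (INR k + 1))).
    + intros k. destruct (HyG k) as (Hl & _ & _ & Hlt).
      replace (Series (fun n => Cmod (fst (yG k) n - x n)%C ^ 2))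
        with (nrm2 (fun n => x n - fst (yG k) n)%C).
      * split; [apply nrm2_nonneg; now apply l2_minus|lra].
      * unfold nrm2. apply Series_ext. intros n. now rewrite Cmod_minus_sym.
    + apply is_lim_seq_const.
    + apply (is_lim_seq_ext (fun k => / INR (S k))).
      * intros k. now rewrite S_INR.
      * apply -> (is_lim_seq_incr_1 (fun k => / INR k)).
        apply (is_lim_seq_inv INR p_infty); [apply is_lim_seq_INR|discriminate].
Qed.

(** [a j] is the moment of order [j] when that moment is continuous. A discontinuous one imposes no
    condition on the closure, so 0 suffices; these zeros are what lowers the codimension when
    summability fails. *)
Lemma decomposition_mod_closure (N : nat) (e : nat -> nat -> C) (E : nat -> C -> C) :
  (1 <= N)%nat ->
  (forall j, (j < N)%nat -> l2 (e j) /\ rep t mu A (e j) (E j) /\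
    forall i, (i < N)%nat -> moment i (e j) (if Nat.eqb i j then RtoC 1 else RtoC 0)) ->
  forall F, InH t mu A F -> exists a h, closureH t mu A (DzN t mu A N) h /\
    (forall j, ~ l2 (bvec j) -> a j = (RtoC 0)) /\
    forall z, F z = (h z + Csum_n (fun i => a i * E i z) (N - 1))%C.
Proof.
  intros HN HE F (x & Hx & HF).
  destruct (functional_choice_nat (fun j v =>
     (l2 (bvec j) -> moment j x v) /\ (~ l2 (bvec j) -> v = RtoC 0))) as [a Ha].
  { intros j. destruct (classic (l2 (bvec j))) as [Hb|Hb].
    - destruct (moment_l2 j x Hb Hx) as [v Hv]. exists v. now split.
    - exists (RtoC 0). split; [contradiction|reflexivity]. }
  destruct (combination_rep a e E (N - 1)) as [Hl Hr].
  { intros i Hi. destruct (HE i ltac:(lia)) as (H1 & H2 & _). now split. }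
  exists a, (fun z => F z + RtoC (-1) * Csum_n (fun i => a i * E i z) (N - 1))%C.
  split; [|split].
  - apply (closure_DzN_intro N
      (fun k => x k + RtoC (-1) * Csum_n (fun i => a i * e i k) (N - 1))%C).
    + apply l2_plus; [assumption|].
      now apply (l2_scal (RtoC (-1)) (fun k => Csum_n (fun i => a i * e i k)%C (N - 1))).
    + apply rep_plus; [assumption|].
      now apply (rep_scal (RtoC (-1)) (fun k => Csum_n (fun i => a i * e i k)%C (N - 1))
                          (fun z => Csum_n (fun i => a i * E i z)%C (N - 1))).
    + intros j Hj. destruct (classic (l2 (bvec j))) as [Hb|Hb]; [right|now left].
      replace (RtoC 0) with (a j + RtoC (-1) * a j)%C by Cring.
      apply moment_plus; [now apply Ha|].
      apply (moment_scal j (RtoC (-1)) (fun k => Csum_n (fun i => a i * e i k)%C (N - 1))).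
      rewrite <- (Csum_n_delta a j (N - 1)) by lia.
      apply combination_moment. intros i Hi. apply HE; lia.
  - intros j Hb. now apply Ha.
  - intros z. Cring.
Qed.

(* If [bvec (N - 1)] were not in l2, the last coefficient of the decomposition modulo
   the closure would vanish for every function. *)
Lemma codim_closure_summable (P : (C -> C) -> Prop) (N : nat) : (1 <= N)%nat ->
  codimH t mu A P N -> (forall F, closureH t mu A (DzN t mu A N) F -> P F) ->
  l2 (bvec (N - 1)).
Proof.
  intros HN HP Hsub. apply NNPP. intros Hb.
  destruct (dual_family N) as (e & E & HE).
  apply (codim_not_spanned P N (N - 1) E HP ltac:(lia)).
  intros F HF. destruct (decomposition_mod_closure N e E HN HE F HF) as (a & h & Hh & Ha & EF).
  exists a, h. split; [now apply Hsub|]. split; [now apply Ha|assumption].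
Qed.

(** * The subspace of vanishing moments *)

Definition moment_free (N : nat) (F : C -> C) : Prop :=
  exists c, l2 c /\ rep t mu A c F /\ forall j, (j < N)%nat -> moment j c (RtoC 0).

Lemma moment_free_subspace (N : nat) : subspaceH t mu A (moment_free N).
Proof.
  split; [|split; [|split]].
  - intros F (c & Hc & HF & _). now exists c.
  - exists (fun _ => RtoC 0). split; [apply l2_zero|]. split; [apply rep_zero|].
    intros j _. refine (Cis_series_ext _ _ _ _ (Cis_series_single 0 (RtoC 0))).
    intros n. simpl. destruct (Nat.eqb n 0); Cring.
  - intros F G (c & Hc & HF & Hm) (d & Hd & HG & Hm').
    exists (fun n => c n + d n)%C. split; [now apply l2_plus|]. split; [now apply rep_plus|].
    intros j Hj. replace (RtoC 0) with (0 + 0)%C by Cring.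
    apply moment_plus; [now apply Hm|now apply Hm'].
  - intros a F (c & Hc & HF & Hm).
    exists (fun n => a * c n)%C. split; [now apply l2_scal|]. split; [now apply rep_scal|].
    intros j Hj. replace (RtoC 0) with (a * 0)%C by Cring. now apply moment_scal, Hm.
Qed.

(** Each moment is a continuous functional here, so its kernel is closed. The sequences provided by
    convergence and by membership agree by [rep_coef_unique]. *)
Lemma moment_free_closed (N : nat) : (forall j, (j < N)%nat -> l2 (bvec j)) ->
  closedH t mu A (moment_free N).
Proof.
  intros Hb Fk F HFk (ck & c & Hck & Hc & HF & Hlim).
  exists c. split; [assumption|]. split; [assumption|]. intros j Hj.
  destruct (moment_l2 j c (Hb j Hj) Hc) as [v Hv].
  replace (RtoC 0) with v; [assumption|].
  apply Cmod_lt_eps_eq. intros eps Heps.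
  destruct (moment_continuous j eps (Hb j Hj) Heps) as (d & Hd & Hcont).
  destruct (proj2 (is_lim_seq_spec _ _) Hlim (mkposreal d Hd)) as [k Hk].
  specialize (Hk k (le_n _)). 
  change (Rabs (Series (fun n => Cmod (ck k n - c n)%C ^ 2) - 0) < d) in Hk.
  apply Rabs_def2 in Hk.
  destruct (Hck k) as [Hl Hr].
  destruct (HFk k) as (c' & Hl' & Hr' & Hm').
  assert (c' = ck k) by (eapply rep_coef_unique; eassumption). subst c'.
  apply (Hcont (fun n => c n - ck k n)%C).
  - now apply l2_minus.
  - replace (nrm2 (fun n => c n - ck k n)%C)
      with (Series (fun n => Cmod (ck k n - c n)%C ^ 2)); [lra|].
    unfold nrm2. apply Series_ext. intros n. now rewrite Cmod_minus_sym.
  - apply moment_minus; [assumption|now apply Hm'].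
Qed.

(** Members of [DzN] have vanishing moments and closedness passes this to limits; the converse is
    [closure_DzN_intro]. The equality of predicates permits rewriting inside [codimH]. *)
Lemma closure_DzN_moment_free (N : nat) : (forall j, (j < N)%nat -> l2 (bvec j)) ->
  closureH t mu A (DzN t mu A N) = moment_free N.
Proof.
  intros Hb. apply functional_extensionality. intros F.
  apply propositional_extensionality. split.
  - intros [_ (Fk & HFk & Hconv)]. apply (moment_free_closed N Hb Fk F); [|assumption].
    intros k. destruct (proj1 (HFk k)) as (c & Hc & Hr). exists c.
    split; [assumption|]. split; [assumption|]. now apply (DzN_moments N (Fk k) c (HFk k)).
  - intros (c & Hc & HF & Hm). apply (closure_DzN_intro N c F Hc HF).
    intros j Hj. right. now apply Hm.
Qed.

(** From c = (t - w) d, the moment of order j + 1 of d is the moment of order j of c plus w times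
    that of d; the recursion starts from the vanishing moment of order 0 given by the division. *)
Lemma moment_free_nearly_invariant (N : nat) : nearly_invariant (moment_free N).
Proof.
  intros f w (c & Hc & Hf & Hm) Hw.
  destruct (division_ex w c f Hc Hf Hw) as (d & Hd & Ec & H0).
  destruct (rep_ex d Hd) as [g Hg]. exists g. split; [|now apply (division_rep w c d)].
  exists d. split; [assumption|]. split; [assumption|].
  induction j as [|j IH]; intros Hj.
  - refine (Cis_series_ext _ _ _ _ H0). intros n. simpl.
    change (d n * s n = 1 * d n * s n)%C. Cring.
  - replace (RtoC 0) with (0 + w * 0)%C by Cring.
    refine (Cis_series_ext _ _ _ _ (Cis_series_plus _ _ _ _ (Hm j ltac:(lia))
              (Cis_series_scal w _ _ (IH ltac:(lia))))).
    intros n. simpl. rewrite Ec.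
    change (pow_n (t n) j * ((t n - w) * d n) * s n + w * (pow_n (t n) j * d n * s n) =
      t n * pow_n (t n) j * d n * s n)%C. Cring.
Qed.

(** The biorthogonal family spans a complement by the decomposition, and is independent because the
    moment of order [i] of a combination reads off [a i]. *)
Lemma moment_free_codim (N : nat) : (1 <= N)%nat -> (forall j, (j < N)%nat -> l2 (bvec j)) ->
  codimH t mu A (moment_free N) N.
Proof.
  intros HN Hb. split; [apply moment_free_subspace|].
  destruct (dual_family N) as (e & E & HE). exists E. split; [|split].
  - intros i Hi. destruct (HE i Hi) as (H1 & H2 & _). now exists (e i).
  - intros F HF.
    destruct (decomposition_mod_closure N e E HN HE F HF) as (a & h & Hh & _ & EF).
    exists a, h. split; [|assumption]. now rewrite <- closure_DzN_moment_free.
  - intros a (c & Hc & Hr & Hm) i Hi.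
    destruct (combination_rep a e E (N - 1)) as [Hl' Hr'].
    { intros k Hk. destruct (HE k ltac:(lia)) as (H1 & H2 & _). now split. }
    assert (Ec := rep_coef_unique _ _ _ Hc Hl' Hr Hr'). subst c.
    rewrite <- (Csum_n_delta a i (N - 1)) by lia.
    apply (moment_unique i (fun k => Csum_n (fun l => a l * e l k)%C (N - 1))).
    + apply combination_moment. intros k Hk. apply HE; lia.
    + now apply Hm.
Qed.

(** All but finitely many nodes have modulus above 1, where higher powers dominate lower ones. *)
Lemma bvec_l2_le (i j : nat) : (i <= j)%nat -> l2 (bvec j) -> l2 (bvec i).
Proof.
  intros Hij Hb. destruct (node_large 1) as [n0 Hn0].
  apply (ex_series_incr_n _ n0). apply (ex_series_incr_n _ n0) in Hb.
  refine (ex_series_Rle _ _ _ Hb). intros n. split; [apply pow2_ge_0|].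
  rewrite !Cmod_bvec. specialize (Hn0 (n0 + n)%nat ltac:(lia)).
  destruct Hdata as (_ & _ & Hmu & _).
  apply Rmult_le_compat_r; [left; apply Hmu|].
  apply Rle_pow; [lra|lia].
Qed.

Lemma bvec_l2_iff (N : nat) :
  ex_series (fun n => Cmod (t n) ^ (2 * N - 2) * mu n) <-> l2 (bvec (N - 1)).
Proof.
  replace (2 * N - 2)%nat with (2 * (N - 1))%nat by lia.
  split; intros H; refine (ex_series_ext _ _ _ H); intros n; simpl;
    [symmetry|]; apply Cmod_bvec.
Qed.

(** * Orthogonality to the functions B_j *)

Lemma Cconj_pow_n (z : C) (j : nat) : Cconj (pow_n z j) = pow_n (Cconj z) j.
Proof.
  induction j as [|j IH].
  - change (Cconj (RtoC 1) = RtoC 1). unfold Cconj, RtoC. simpl. f_equal. ring.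
  - rewrite !Cpow_nS, Cmult_conj, IH. reflexivity.
Qed.

Lemma Cconj_RtoC (x : R) : Cconj (RtoC x) = RtoC x.
Proof. unfold Cconj, RtoC. simpl. f_equal. ring. Qed.

Lemma pairing_Bcoef (c : nat -> C) (j n : nat) :
  (c n * Cconj (Bcoef t mu j n))%C = (pow_n (t n) j * c n * s n)%C.
Proof.
  unfold Bcoef. rewrite Cmult_conj, Cconj_pow_n, Cconj_conj, Cconj_RtoC. Cring.
Qed.

Lemma Bcoef_l2 (j : nat) : l2 (bvec j) -> l2 (Bcoef t mu j).
Proof.
  apply l2_le. intros n. unfold Bcoef, bvec.
  rewrite !Cmod_mult, !Cmod_pow_n, Cmod_conj. apply Rle_refl.
Qed.

(** [isInner] hides its coefficient sequences; uniqueness identifies them with those of F and B_j,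
    and the inner product becomes the moment of order j. *)
Lemma perpB_moment_free (N : nat) (F : C -> C) : (forall j, (j < N)%nat -> l2 (bvec j)) ->
  perpB t mu A N F <-> moment_free N F.
Proof.
  intros Hb. split.
  - intros [(c & Hc & HF) Hperp]. exists c. split; [assumption|]. split; [assumption|].
    intros j Hj. destruct (Hperp j Hj) as (B & HB & c' & d & Hc' & HF' & Hd & HB' & Hs).
    assert (c' = c) by (eapply rep_coef_unique; eassumption). subst c'.
    assert (d = Bcoef t mu j)
      by (eapply rep_coef_unique; eauto using Bcoef_l2). subst d.
    refine (Cis_series_ext _ _ _ _ Hs). intros n. apply pairing_Bcoef.
  - intros (c & Hc & HF & Hm). split; [now exists c|]. intros j Hj.
    assert (Hl := Bcoef_l2 j (Hb j Hj)). destruct (rep_ex _ Hl) as [B HB].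
    exists B. split; [assumption|]. exists c, (Bcoef t mu j).
    repeat (split; [assumption|]).
    refine (Cis_series_ext _ _ _ _ (Hm j Hj)). intros n. symmetry. apply pairing_Bcoef.
Qed.

(** * Comparison with an arbitrary nearly invariant subspace *)

Lemma closure_subset (P : (C -> C) -> Prop) (N : nat) (F : C -> C) : (1 <= N)%nat ->
  closedH t mu A P -> nearly_invariant P -> codimH t mu A P N ->
  closureH t mu A (DzN t mu A N) F -> P F.
Proof.
  intros HN Hcl Hinv Hcod [_ (Fk & HFk & Hconv)].
  apply (Hcl Fk F); [|assumption]. intros k.
  now apply (nearly_invariant_contains_DzN P N).
Qed.

(** If [F] had a nonzero coordinate a_p modulo the closure, E_p could be expressed through F, the
    closure and the other E_i. Since F and the closure lie in [P], N - 1 functions would span modulo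
    [P]. *)
Lemma nearly_invariant_unique (P : (C -> C) -> Prop) (N : nat) (F : C -> C) : (1 <= N)%nat ->
  closed_subspaceH t mu A P -> nearly_invariant P -> codimH t mu A P N ->
  P F -> closureH t mu A (DzN t mu A N) F.
Proof.
  intros HN [(Hsub & H0 & Hadd & Hscal) Hcl] Hinv Hcod HF.
  destruct (dual_family N) as (e & E & HE).
  assert (Hdec := decomposition_mod_closure N e E HN HE).
  destruct (Hdec F (Hsub F HF)) as (a & h & Hh & _ & EF).
  destruct (classic (exists p, (p < N)%nat /\ a p <> (RtoC 0))) as [(p & Hp & Hap)|Hno].
  - exfalso. apply (codim_not_spanned P N p E Hcod Hp). intros G HG.
    destruct (Hdec G HG) as (b & g & Hg & _ & EG).
    (* The combination F - h of the E_i lies in [P]; moving (b_p / a_p)(F - h) into the component in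
       [P] removes coordinate p of [G]. *)
    exists (fun i => b i + (- (b p / a p)) * a i)%C,
      (fun z => g z + (b p / a p) * (F z + RtoC (-1) * h z))%C.
    split; [|split].
    + apply (Hadd g); [now apply (closure_subset P N)|].
      apply (Hscal _ (fun z => F z + RtoC (-1) * h z)%C).
      apply (Hadd F); [assumption|]. apply Hscal. now apply (closure_subset P N).
    + field. assumption.
    + intros z. rewrite EG, EF.
      rewrite (Csum_n_ext (fun i => (b i + - (b p / a p) * a i) * E i z)%C
        (fun i => b i * E i z + (- (b p / a p)) * (a i * E i z))%C) by (intros; Cring).
      rewrite Csum_n_plus, Csum_n_mult_l. Cring.
  - replace F with h; [assumption|]. apply functional_extensionality. intros z.
    rewrite EF, Csum_n_zero; [Cring|]. intros i Hi.
    replace (a i) with (RtoC 0); [Cring|].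
    apply NNPP. intros Hai. apply Hno. exists i. split; [lia|]. congruence.
Qed.

End CauchyDeBranges.

Theorem theorem1p8 (t : nat -> C) (mu : nat -> R) (A : C -> C) (N : nat) :
  CdB_data t mu A -> (1 <= N)%nat ->
  let cond_i := exists H0, closed_subspaceH t mu A H0 /\ nearly_invariant H0 /\
                           codimH t mu A H0 N in
  let cond_ii := codimH t mu A (closureH t mu A (DzN t mu A N)) N in
  let cond_iii := ex_series (fun n => (Cmod (t n)) ^ (2 * N - 2) * mu n) in
  (cond_i <-> cond_ii) /\ (cond_ii <-> cond_iii) /\
  (cond_iii ->
     (forall H0, closed_subspaceH t mu A H0 -> nearly_invariant H0 ->
        codimH t mu A H0 N ->
        forall F, H0 F <-> closureH t mu A (DzN t mu A N) F) /\
     (forall F, closureH t mu A (DzN t mu A N) F <-> perpB t mu A N F)).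
Proof.
  intros Hdata HN cond_i cond_ii cond_iii.
  assert (Hb : cond_iii -> forall j, (j < N)%nat -> l2 (bvec t mu j)).
  { intros H j Hj. apply (bvec_l2_le t mu A Hdata j (N - 1)); [lia|].
    now apply (bvec_l2_iff t mu A Hdata N). }
  assert (H13 : cond_i -> cond_iii).
  { intros (P & [_ Hcl] & Hinv & Hcod). apply (bvec_l2_iff t mu A Hdata N).
    apply (codim_closure_summable t mu A Hdata P N HN Hcod).
    intros F. now apply (closure_subset t mu A Hdata). }
  assert (H23 : cond_ii -> cond_iii).
  { intros Hcod. apply (bvec_l2_iff t mu A Hdata N).
    now apply (codim_closure_summable t mu A Hdata _ N HN Hcod). }
  assert (H31 : cond_iii -> cond_i).
  { intros H. exists (moment_free t mu A N). split; [split|split].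
    - now apply moment_free_subspace.
    - now apply moment_free_closed; [|apply Hb].
    - now apply moment_free_nearly_invariant.
    - now apply moment_free_codim; [| |apply Hb]. }
  assert (H32 : cond_iii -> cond_ii).
  { intros H. unfold cond_ii. rewrite closure_DzN_moment_free by (assumption || now apply Hb).
    now apply moment_free_codim; [| |apply Hb]. }
  split; [split; auto|]. split; [split; auto|]. intros H. split.
  - intros P HP Hinv Hcod F. split.
    + now apply (nearly_invariant_unique t mu A Hdata).
    + apply (closure_subset t mu A Hdata); try assumption. apply HP.
  - intros F. rewrite closure_DzN_moment_free by (assumption || now apply Hb).
    symmetry. apply perpB_moment_free; [assumption|now apply Hb].
Qed.
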